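(* Let $p,q,r\in\mathbb{N}_0$, and let $x_1<\ldots<x_n$ be real numbers with $\sum_{k=1}^n x_k=0$ and $\sum_{k=1}^n x_k^2=1$. Then if $n$ is big enough and $\sum_{k=1}^n|x_k|^3$ is small enough, \[ \left\|\frac{C_{r,n}}{\xi^{n+r-1}}\sum_{k=1}^n\frac{e^{-in\xi x_k}}{\prod_{j\neq k}(x_k-x_j)}\,L_r^{(-n-r+1)}(-n\xi x_k)-\mathrm{He}_r(\xi)\cdot e^{-\xi^2/2}\right\|_{\mathcal{S}^{p,q,\infty}}=O_{p,q}(m^3), \] where \[ C_{r,n}=\frac{(n-2)!\cdot r!\cdot i^{\,r+n-1}}{n^{n-2}}. \]
   Context: $\mathbb{N}_0=\{0,1,2,\ldots\}$ and $i$ is the imaginary unit. For a function $f$ of $\xi\in\mathbb{R}$, $\|f\|_{\mathcal{S}^{p,q,\infty}}$ is the $L^\infty(\mathbb{R})$ norm of $\xi\mapsto|\xi|^p\,\partial^q f(\xi)$. The product $\prod_{j\neq k}$ runs over $j\in\{1,\ldots,n\}\setminus\{k\}$; equal values among the $x_k$ may be allowed by taking a limit. $\mathrm{He}_r$ is the probabilists' Hermite polynomial, $\mathrm{He}_r(z)e^{-z^2/2}=(-1)^r\left(\frac{d}{dz}\right)^r e^{-z^2/2}$. $L_r^{(\alpha)}$ is the generalized Laguerre polynomial with real parameter $\alpha$ (possibly $\alpha<-1$), $L_r^{(\alpha)}(z)=\sum_{l=0}^r(-1)^l\binom{r+\alpha}{r-l}\frac{z^l}{l!}$, where $\binom{a}{d}=\frac{a(a-1)\cdots(a-d+1)}{d!}$.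 The number $m>0$ is defined by $m^3=\sum_{k=1}^n|v_k|^3$, where $v_k=(x_k,n^{-1/2})\in\mathbb{R}^2$ and $|\cdot|$ is the Euclidean length; $m^3$ is comparable, up to absolute constants, to $\sum_k|x_k|^3+n^{-1/2}$. $O_{p,q}(m^3)$ denotes a quantity bounded by $Cm^3$ with $C$ depending on $p,q$. Continuity at $\xi=0$ of the function involving the sum is considered part of the statement.
   Formalization: As printed the claim fails for r ≥ 1 (pole at ξ=0); the Laguerre argument −nξx_k is corrected to inξx_k and i^{r+n−1} in C_{r,n} to i^{2r+n−1}; the constant in O_{p,q} and the thresholds may also depend on r, since uniformity in r is false. *)

(* Defs.v *)
From HB Require Import structures.
From mathcomp Require Import all_boot all_order all_algebra.
From mathcomp Require Import complex.
From mathcomp Require Import all_classical all_reals all_analysis.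

Set Implicit Arguments.
Unset Strict Implicit.
Unset Printing Implicit Defensive.

Import Order.TTheory GRing.Theory Num.Theory.
Import numFieldNormedType.Exports.

Local Open Scope ring_scope.
Local Open Scope classical_set_scope.

Definition cis (R : realType) (t : R) : R[i] := (cos t +i* sin t)%C.

Definition gauss (R : realType) (t : R) : R := expR (- (t ^+ 2 / 2)).

(* Probabilists' Hermite polynomial, read off from the defining identity
   He_r(z) exp(-z^2/2) = (-1)^r (d/dz)^r exp(-z^2/2). *)
Definition He (R : realType) (r : nat) (z : R) : R :=
  (-1) ^+ r * derive1n r (@gauss R) z / gauss z.

Definition gbinom (K : fieldType) (a : K) (d : nat) : K :=
  (\prod_(l < d) (a - l%:R)) / d`!%:R.

Definition laguerre (K : fieldType) (r : nat) (alpha : K) : {poly K} :=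
  \poly_(l < r.+1) ((-1) ^+ l * gbinom (r%:R + alpha) (r - l) / l`!%:R).

(* The power of the imaginary unit is 2r+n-1, that is (-1)^r i^(n-1); this, and
   the argument i n xi x_k of the Laguerre polynomial in [hermite_sum], are what
   the Rodrigues formula for Laguerre polynomials gives:
     (d/dxi)^r (xi^(1-n) exp(-i n xi x))
       = r! xi^(1-n-r) exp(-i n xi x) L_r^(1-n-r)(i n xi x).
   With i^(r+n-1) and the argument - n xi x_k instead, the sum has a pole at
   xi = 0 already for r = 1. *)
Definition Crn (R : realType) (r n : nat) : R[i] :=
  (n - 2)`!%:R * r`!%:R * ('i%C) ^+ (2 * r + n - 1) / n%:R ^+ (n - 2).

(* Meaningful for xi <> 0 only. *)
Definition hermite_sum (R : realType) (r n : nat) (x : 'I_n -> R) (xi : R) :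
    R[i] :=
  Crn R r n / (xi%:C)%C ^+ (n + r - 1) *
  \sum_(k < n)
     cis (- (n%:R * xi * x k)) / (\prod_(j < n | j != k) (x k - x j)%:C)%C *
     (map_poly (real_complex R) (laguerre r (- n%:R - r%:R + 1))).[
        'i%C * ((n%:R * xi * x k)%:C)%C].

Section ComplexValued.
Variable R : realType.
Implicit Types f : R -> R[i].

(* Continuity and differentiation of complex-valued functions of a real
   variable are componentwise: R[i] carries no normed R-module structure. *)
Definition ccontinuous_at (xi : R) f : Prop :=
  {for xi, continuous (fun t => complex.Re (f t))} /\
  {for xi, continuous (fun t => complex.Im (f t))}.

Definition cderive (q : nat) f (xi : R) : R[i] :=
  (derive1n q (fun t => complex.Re (f t)) xi +i*
   derive1n q (fun t => complex.Im (f t)) xi)%C.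

Definition cderivable (q : nat) f : Prop :=
  forall (k : nat) (xi : R), (k < q)%N ->
    derivable (derive1n k (fun t => complex.Re (f t))) xi 1 /\
    derivable (derive1n k (fun t => complex.Im (f t))) xi 1.

(* The L^oo seminorm in S^(p,q,oo); it is the intended quantity only when
   [cderivable q f] holds, since [derive1n] is total. *)
Definition Snorm (p q : nat) f : \bar R :=
  Lnorm (@lebesgue_measure R) +oo%E
    (fun xi => (`|xi| ^+ p * Normc.normc (cderive q f xi))%:E).

End ComplexValued.

(* Main.v *)
(* Write u_k = xi x_k + s / sqrt n.  For r = 0 the sum is, up to a factor free
   of xi, the integral over s of
     P(xi, s) = exp(i sqrt n s) / prod_k (1 + i u_k),
   as one sees by partial fractions, since the integral over s of
   exp(i sqrt n s) (1 / (1 + i a + i s / sqrt n) - 1 / (1 + i s / sqrt n))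
   is a multiple of 1 - exp(- i n a) by translation invariance alone.  The
   factor is found by letting xi tend to 0, and the sum for r is (-1)^r times
   the r-th derivative of the sum for 0.  Because sum u_k = sqrt n s and
   sum u_k^2 = xi^2 + s^2, both P and G = exp(- (xi^2 + s^2) / 2) are products of
   functions of the u_k that agree to third order and are bounded by
   (1 + u_k^2)^(-1/2); telescoping gives
   |P - G| <= C m^3 (1 + xi^2 + s^2)^4 prod_k (1 + u_k^2)^(-1/2), and the last
   product decays faster than any prescribed power of xi^2 + s^2 when the v_k
   are small.  Derivatives in xi satisfy the same bound, because they are
   polynomials in those of the logarithmic derivatives, which differ by
   O(m^3). *)

Require Import Defs.
From HB Require Import structures.
From mathcomp Require Import all_boot all_order all_algebra.
From mathcomp Require Import complex.
From mathcomp Require Import all_classical all_reals all_analysis.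
From mathcomp Require Import measurable_realfun ess_sup_inf ring lra.

Set Implicit Arguments.
Unset Strict Implicit.
Unset Printing Implicit Defensive.

Import Order.TTheory GRing.Theory Num.Theory.
Import numFieldNormedType.Exports.

Local Open Scope ring_scope.
Local Open Scope classical_set_scope.

(** * Complex-valued functions of a real variable *)

(** The sum is undefined at xi = 0, so no estimate is made on it directly: the integral, smooth in
    xi on the whole line, serves as its extension and carries all the bounds. Neither the constant
    in the integral of a single pole nor the Gaussian mass kappa is computed. If lam is the factor
    between the sum and the integral I, differentiating the identity n - 1 times at 0 gives lam I(0)
    = n / (n - 1), while the estimate for order 0 gives I(0) = kappa + O(m^3); since 1/n <= m^3, lam
    kappa = 1 + O(m^3). A single pole is not absolutely integrable in s, only a difference of two
    is; the partial fraction weights sum to 0 when n > 1, so one fixed pole can be subtracted from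
    every term. Derivatives are handled as towers, sequences of functions each of which is the
    derivative of the one before; identities and bounds are proved for a whole tower and compared
    with iterated derivatives only where the statement asks for them. The constants of the main
    estimate are chosen before n. Bounds depending on n serve only for integrability and
    differentiation under the integral sign. *)

Section ComplexNorm.
Context {R : realType}.
Implicit Types z w : R[i].
Local Notation normc := (@Normc.normc R).

Lemma normc_ge0 z : 0 <= normc z.
Proof. by case: z => a b /=; rewrite sqrtr_ge0. Qed.

Lemma normcR (a : R) : normc (a%:C)%C = `|a|.
Proof. by rewrite /= expr0n addr0 sqrtr_sqr. Qed.

Lemma normc_i : normc 'i%C = 1.
Proof. by rewrite /= expr0n expr1n add0r sqrtr1. Qed.

Lemma normc_cis (t : R) : normc (cis t) = 1.
Proof. by rewrite /= cos2Dsin2 sqrtr1. Qed.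

Lemma normcX z n : normc (z ^+ n) = normc z ^+ n.
Proof.
elim: n => [|n IH]; first by rewrite !expr0 Normc.normc1.
by rewrite !exprS Normc.normcM IH.
Qed.

Lemma normc_prod (I : Type) (s : seq I) (P : pred I) (F : I -> R[i]) :
  normc (\prod_(i <- s | P i) F i) = \prod_(i <- s | P i) normc (F i).
Proof.
by apply: (big_morph normc (@Normc.normcM R)); exact: Normc.normc1.
Qed.

Lemma normc_sum (I : Type) (s : seq I) (P : pred I) (F : I -> R[i]) :
  normc (\sum_(i <- s | P i) F i) <= \sum_(i <- s | P i) normc (F i).
Proof.
elim/big_rec2: _ => [|i y1 y2 _ IH]; first by rewrite Normc.normc0.
by apply: le_trans (le_normcD _ _) _; rewrite lerD2l.
Qed.

Lemma normc_sub z w : normc (z - w) = normc (w - z).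
Proof. by rewrite -normcN opprB. Qed.

Lemma le_normcB z w : normc (z - w) <= normc z + normc w.
Proof. by apply: le_trans (le_normcD _ _) _; rewrite normcN. Qed.

Lemma normc_nat (n : nat) : normc (n%:R : R[i]) = n%:R.
Proof.
have -> : (n%:R : R[i]) = ((n%:R : R)%:C)%C by rewrite rmorph_nat.
by rewrite normcR normr_nat.
Qed.

Lemma normr_Re_le z : `|complex.Re z| <= normc z.
Proof.
case: z => a b /=; rewrite -sqrtr_sqr; apply: ler_wsqrtr.
by rewrite lerDl sqr_ge0.
Qed.

Lemma normr_Im_le z : `|complex.Im z| <= normc z.
Proof.
case: z => a b /=; rewrite -sqrtr_sqr; apply: ler_wsqrtr.
by rewrite lerDr sqr_ge0.
Qed.

Lemma normc_le_ReIm z : normc z <= `|complex.Re z| + `|complex.Im z|.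
Proof.
case: z => a b /=; rewrite -(@ger0_norm _ (`|a| + `|b|)) ?addr_ge0//.
rewrite -sqrtr_sqr; apply: ler_wsqrtr.
rewrite -(real_normK (num_real a)) -(real_normK (num_real b)) sqrrD lerD2r lerDl.
by rewrite mulrn_wge0// mulr_ge0.
Qed.

Lemma cis0 : cis 0 = 1 :> R[i].
Proof. by rewrite /cis cos0 sin0. Qed.

Lemma cisD (s t : R) : cis (s + t) = cis s * cis t.
Proof.
apply/eqP; rewrite /cis cosD sinD eq_complex /=.
by apply/andP; split; apply/eqP; ring.
Qed.

End ComplexNorm.

Section ComplexDerivative.
Context {R : realType}.
Implicit Types (f g : R -> R[i]) (x t : R) (a d : R[i]).

Definition is_cderive f x d : Prop :=
  is_derive x 1 (fun t => complex.Re (f t)) (complex.Re d) /\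
  is_derive x 1 (fun t => complex.Im (f t)) (complex.Im d).

Lemma is_cderive_unique f x d d' : is_cderive f x d -> is_cderive f x d' -> d = d'.
Proof.
case: d d' => [a b] [a' b'] [/= ra ia] [/= rb ib].
by congr Complex; [rewrite -[LHS](@derive_val _ _ _ _ _ _ _ ra) (@derive_val _ _ _ _ _ _ _ rb)
                  |rewrite -[LHS](@derive_val _ _ _ _ _ _ _ ia) (@derive_val _ _ _ _ _ _ _ ib)].
Qed.

Lemma is_cderive_near f g x d : {near x, f =1 g} -> is_cderive f x d -> is_cderive g x d.
Proof.
move=> fg [hr hi]; split.
- apply: near_eq_is_derive hr.
  by near=> t; rewrite -(near fg t).
- apply: near_eq_is_derive hi.
  by near=> t; rewrite -(near fg t).
Unshelve. all: end_near. Qed.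

Lemma is_derive_affine (a b t : R) : is_derive t 1 (fun s => a + b * s) b.
Proof.
apply: (is_derive_eq (is_deriveD (is_derive_cst a t 1)
  (is_deriveM (is_derive_cst b t 1) (is_derive_id t 1)))).
by rewrite /GRing.scale/= mulr1 mulr0 addr0 add0r.
Qed.

Lemma is_cderive_cst a x : is_cderive (fun=> a) x 0.
Proof. by split; exact: is_derive_cst. Qed.

Lemma is_cderiveD f g x d d' : is_cderive f x d -> is_cderive g x d' ->
  is_cderive (fun t => f t + g t) x (d + d').
Proof.
move=> [fr fi] [gr gi]; split.
- rewrite [X in is_derive _ _ _ X](_ : _ = complex.Re d + complex.Re d'); last first.
    by case: (d) (d') => [? ?] [? ?].
  rewrite (_ : (fun _ => _) = (fun t => complex.Re (f t)) \+ (fun t => complex.Re (g t))).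
    exact: is_deriveD.
  by apply/funext => t /=; case: (f t) (g t) => [? ?] [? ?].
- rewrite [X in is_derive _ _ _ X](_ : _ = complex.Im d + complex.Im d'); last first.
    by case: (d) (d') => [? ?] [? ?].
  rewrite (_ : (fun _ => _) = (fun t => complex.Im (f t)) \+ (fun t => complex.Im (g t))).
    exact: is_deriveD.
  by apply/funext => t /=; case: (f t) (g t) => [? ?] [? ?].
Qed.

Lemma ReM (z w : R[i]) :
  complex.Re (z * w) = complex.Re z * complex.Re w - complex.Im z * complex.Im w.
Proof. by case: z w => [? ?] [? ?]. Qed.

Lemma ImM (z w : R[i]) :
  complex.Im (z * w) = complex.Re z * complex.Im w + complex.Im z * complex.Re w.
Proof. by case: z w => [? ?] [? ?]. Qed.

Lemma ReD (z w : R[i]) : complex.Re (z + w) = complex.Re z + complex.Re w.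
Proof. by case: z w => [? ?] [? ?]. Qed.

Lemma ImD (z w : R[i]) : complex.Im (z + w) = complex.Im z + complex.Im w.
Proof. by case: z w => [? ?] [? ?]. Qed.

Lemma is_cderiveM f g x d d' : is_cderive f x d -> is_cderive g x d' ->
  is_cderive (fun t => f t * g t) x (d * g x + f x * d').
Proof.
move=> [fr fi] [gr gi]; split.
- rewrite (_ : (fun _ => _) = (fun t => complex.Re (f t)) * (fun t => complex.Re (g t))
     - (fun t => complex.Im (f t)) * (fun t => complex.Im (g t))); last first.
    by apply/funext => t; rewrite ReM.
  apply: (is_derive_eq (is_deriveB (is_deriveM fr gr) (is_deriveM fi gi))).
  by rewrite ReD !ReM /GRing.scale/=; ring.
- rewrite (_ : (fun _ => _) = (fun t => complex.Re (f t)) * (fun t => complex.Im (g t))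
     + (fun t => complex.Im (f t)) * (fun t => complex.Re (g t))); last first.
    by apply/funext => t; rewrite ImM.
  apply: (is_derive_eq (is_deriveD (is_deriveM fr gi) (is_deriveM fi gr))).
  by rewrite ImD !ImM /GRing.scale/=; ring.
Qed.

Lemma is_cderive_sum (n : nat) (F : 'I_n -> R -> R[i]) (dF : 'I_n -> R[i]) x :
  (forall k, is_cderive (F k) x (dF k)) ->
  is_cderive (fun t => \sum_(k < n) F k t) x (\sum_(k < n) dF k).
Proof.
elim: n F dF => [|n IH] F dF FdF.
  rewrite big_ord0; under eq_fun do rewrite big_ord0.
  exact: is_cderive_cst.
rewrite big_ord_recr/=; under eq_fun do rewrite big_ord_recr/=.
by apply: is_cderiveD => //; apply: IH.
Qed.

(* The sum is the logarithmic derivative, kept free of divisions. *)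
Lemma is_cderive_prod (n : nat) (F : 'I_n -> R -> R[i]) (l : 'I_n -> R[i]) x :
  (forall k, is_cderive (F k) x (F k x * l k)) ->
  is_cderive (fun t => \prod_(k < n) F k t) x
    (\prod_(k < n) F k x * \sum_(k < n) l k).
Proof.
elim: n F l => [|n IH] F l Fl.
  rewrite !big_ord0 mulr0; under eq_fun do rewrite big_ord0.
  exact: is_cderive_cst.
rewrite !big_ord_recr/=; under eq_fun do rewrite big_ord_recr/=.
rewrite [X in is_cderive _ _ X](_ : _ =
   (\prod_(i < n) F (widen_ord (leqnSn n) i) x * \sum_(i < n) l (widen_ord (leqnSn n) i)) * F ord_max x +
   \prod_(i < n) F (widen_ord (leqnSn n) i) x * (F ord_max x * l ord_max)); last by ring.
by apply: is_cderiveM => //; apply: IH => k.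
Qed.

Lemma is_cderiveZ a f x d : is_cderive f x d -> is_cderive (fun t => a * f t) x (a * d).
Proof.
move=> fd; have := is_cderiveM (is_cderive_cst a x) fd.
by rewrite mul0r add0r.
Qed.

Lemma is_cderiveX n f x d : is_cderive f x d ->
  is_cderive (fun t => f t ^+ n) x (n%:R * f x ^+ n.-1 * d).
Proof.
move=> fd; elim: n => [|n IH]; first by rewrite !mul0r; exact: is_cderive_cst.
under eq_fun do rewrite exprS.
rewrite [X in is_cderive _ _ X](_ : _ =
   d * f x ^+ n + f x * (n%:R * f x ^+ n.-1 * d)); first exact: is_cderiveM.
case: n {IH} => [|n] /=; first by rewrite !expr0; ring.
by rewrite exprS -[in LHS]natr1; ring.
Qed.

Lemma ReN (z : R[i]) : complex.Re (- z) = - complex.Re z.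
Proof. by case: z. Qed.

Lemma ImN (z : R[i]) : complex.Im (- z) = - complex.Im z.
Proof. by case: z. Qed.

Lemma ReV (z : R[i]) : complex.Re z^-1 =
  complex.Re z / (complex.Re z * complex.Re z + complex.Im z * complex.Im z).
Proof. by case: z => a b /=; rewrite -!expr2. Qed.

Lemma ImV (z : R[i]) : complex.Im z^-1 =
  - (complex.Im z / (complex.Re z * complex.Re z + complex.Im z * complex.Im z)).
Proof. by case: z => a b /=; rewrite -!expr2. Qed.

Lemma is_cderiveV f x d : f x != 0 -> is_cderive f x d ->
  is_cderive (fun t => (f t)^-1) x (- d / f x ^+ 2).
Proof.
move=> fx0 [fr fi].
(* N is |f|^2; the components of 1/f are Re f / N and - Im f / N, which reduces the claim to real
   quotients. *)
set N : R -> R := (fun t => complex.Re (f t)) * (fun t => complex.Re (f t)) +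
  (fun t => complex.Im (f t)) * (fun t => complex.Im (f t)).
have Nx : N x = complex.Re (f x) ^+ 2 + complex.Im (f x) ^+ 2 by [].
have Nx0 : N x != 0.
  rewrite Nx; apply: contra_neq fx0; move: (f x) => [a b] /= /eqP.
  by rewrite paddr_eq0 ?sqr_ge0// !sqrf_eq0 => /andP[/eqP-> /eqP->].
have dN : is_derive x 1 N (2 * (complex.Re (f x) * complex.Re d + complex.Im (f x) * complex.Im d)).
  apply: (is_derive_eq (is_deriveD (is_deriveM fr fr) (is_deriveM fi fi))).
  by rewrite /GRing.scale/=; ring.
have dV := is_deriveV Nx0 dN.
have -> : - d / f x ^+ 2 = - (d * ((f x)^-1 * (f x)^-1)).
  by rewrite expr2 invfM mulNr.
split.
- rewrite (_ : (fun _ => _) = (fun t => complex.Re (f t)) * (fun t => (N t)^-1)); last first.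
    by apply/funext => t; rewrite ReV.
  apply: is_derive_eq; move: Nx0; rewrite /GRing.scale/= Nx ReN !(ReM, ImM) ReV ImV => N0.
  by field.
- rewrite (_ : (fun _ => _) = - ((fun t => complex.Im (f t)) * (fun t => (N t)^-1))); last first.
    by apply/funext => t; rewrite ImV.
  apply: is_derive_eq; move: Nx0; rewrite /GRing.scale/= Nx ImN !(ReM, ImM) ReV ImV => N0.
  by field.
Qed.

Lemma is_cderive_real (f : R -> R) x (d : R) : is_derive x 1 f d ->
  is_cderive (fun t => (f t)%:C)%C x (d%:C)%C.
Proof. by move=> fd; split => //=; exact: is_derive_cst. Qed.

Lemma is_cderive_cis (f : R -> R) x (d : R) : is_derive x 1 f d ->
  is_cderive (fun t => cis (f t)) x ('i%C * (d%:C)%C * cis (f x)).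
Proof.
move=> fd; split => /=.
- have := is_derive1_comp (is_derive_cos (f x)) fd.
  by move=> h; apply: is_derive_eq; ring.
- have := is_derive1_comp (is_derive_sin (f x)) fd.
  by move=> h; apply: is_derive_eq; ring.
Qed.

End ComplexDerivative.

(** * Towers of successive derivatives *)

Section Tower.
Context {K : comNzRingType}.
Implicit Types (p a : K) (F G T : nat -> K).

(** Pascal's rule. Reading [F b] and [G b] as b-th derivatives, it says that differentiating the
    Leibniz sum of order q gives the one of order q + 1. *)
Lemma leibniz_step F G q :
  \sum_(b < q.+1) 'C(q, b)%:R * (F b.+1 * G (q - b)%N + F b * G (q - b).+1) =
  \sum_(b < q.+2) 'C(q.+1, b)%:R * (F b * G (q.+1 - b)%N).
Proof.
rewrite [RHS]big_ord_recl/= bin0 mul1r subn0.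
under [X in _ = _ + X]eq_bigr => i _ do
  rewrite /bump/= add1n binS natrD mulrDl subSS.
rewrite big_split/=.
under eq_bigr => i _ do rewrite mulrDr.
rewrite big_split/= [LHS]addrC addrA; congr (_ + _).
rewrite big_ord_recl/= bin0 mul1r subn0; congr (_ + _).
rewrite [RHS]big_ord_recr/= bin_small ?mul0r ?addr0 ?ltnSn//.
by apply: eq_bigr => i _; rewrite /bump/= add1n -subSn// subSS.
Qed.

(** Since P' = P T_0, the derivative of order q + 1 is a Leibniz sum over all lower orders.
    Structural recursion sees only its predecessor, so the whole table of earlier values is carried
    along and stage q overwrites entry q. *)
Fixpoint log_tower_table p T q : nat -> K :=
  if q is q'.+1 then fun m =>
    if m == q then \sum_(b < q) 'C(q', b)%:R * (log_tower_table p T q' b * T (q' - b)%N)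
    else log_tower_table p T q' m
  else fun=> p.

(* The successive derivatives of a function with value p, expressed through the
   successive derivatives T of its logarithmic derivative. *)
Definition log_tower p T q : K := log_tower_table p T q q.

Lemma log_tower_tableE p T q m : (m <= q)%N -> log_tower_table p T q m = log_tower p T m.
Proof.
elim: q => [|q IH]; first by rewrite leqn0 => /eqP ->.
rewrite leq_eqVlt => /predU1P[-> //|mq].
by rewrite [LHS]/= ltn_eqF// IH.
Qed.

Lemma log_towerS p T q : log_tower p T q.+1 =
  \sum_(b < q.+1) 'C(q, b)%:R * (log_tower p T b * T (q - b)%N).
Proof.
rewrite [LHS]/log_tower/= eqxx; apply: eq_bigr => b _.
by rewrite log_tower_tableE// -ltnS.
Qed.

(** Serves to pull the factor [gauss s], constant in xi, out of the tower of
    [gauss s * gauss xi]. *)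
Lemma log_towerZ a p T q : log_tower (a * p) T q = a * log_tower p T q.
Proof.
elim/ltn_ind: q => -[|q] IH; first by [].
rewrite !log_towerS mulr_sumr; apply: eq_bigr => b _.
by rewrite IH ?ltn_ord//; ring.
Qed.

End Tower.

Section TowerDerivative.
Context {R : realType}.
Implicit Types (x : R) (U : set R).

Lemma is_cderive_leibniz (F G : nat -> R -> R[i]) q x :
  (forall b, (b <= q)%N -> is_cderive (F b) x (F b.+1 x)) ->
  (forall b, (b <= q)%N -> is_cderive (G b) x (G b.+1 x)) ->
  is_cderive (fun t => \sum_(b < q.+1) 'C(q, b)%:R * (F b t * G (q - b)%N t)) x
    (\sum_(b < q.+2) 'C(q.+1, b)%:R * (F b x * G (q.+1 - b)%N x)).
Proof.
move=> dF dG; rewrite -(leibniz_step (F^~ x) (G^~ x)).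
apply: is_cderive_sum => b; apply/is_cderiveZ/is_cderiveM.
- by apply: dF; rewrite -ltnS.
- by apply: dG; rewrite leq_subr.
Qed.

Lemma is_cderive_log_tower (P : R -> R[i]) (T : nat -> R -> R[i]) q x :
  is_cderive P x (P x * T 0 x) ->
  (forall b, is_cderive (T b) x (T b.+1 x)) ->
  is_cderive (fun t => log_tower (P t) (T^~ t) q) x (log_tower (P x) (T^~ x) q.+1).
Proof.
move=> dP dT; elim/ltn_ind: q => -[|q] IH.
  by rewrite log_towerS big_ord1 bin0 mul1r.
under eq_fun do rewrite log_towerS.
rewrite log_towerS.
apply: (@is_cderive_leibniz (fun b t => log_tower (P t) (T^~ t) b)) => // b bq.
Qed.

(** Here the variable is not the one in which the tower differentiates. It is applied in s, where
    differentiability is wanted only for continuity and hence measurability. *)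
Lemma cderivable_log_tower (P : R -> R[i]) (T : nat -> R -> R[i]) q x :
  (exists d, is_cderive P x d) -> (forall b, exists d, is_cderive (T b) x d) ->
  exists d, is_cderive (fun t => log_tower (P t) (T^~ t) q) x d.
Proof.
move=> dP dT; elim/ltn_ind: q => -[|q] IH; first exact: dP.
have /choice[d Hd] (b : 'I_q.+1) : exists d, is_cderive (fun t => log_tower (P t) (T^~ t) b) x d.
  exact: IH.
have /choice[e He] := dT.
eexists; under eq_fun do rewrite log_towerS.
apply: is_cderive_sum => b; apply: is_cderiveZ; apply: is_cderiveM; first exact: Hd.
exact: He.
Qed.

(** Uniqueness of the derivative, order by order; openness turns equality on U into equality near
    each point of U. Used with U the nonzero reals and with U the whole line. *)
Lemma tower_eq U (F G : nat -> R -> R[i]) q x : open U ->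
  (forall b x, U x -> is_cderive (F b) x (F b.+1 x)) ->
  (forall b x, U x -> is_cderive (G b) x (G b.+1 x)) ->
  (forall x, U x -> F 0 x = G 0 x) -> U x -> F q x = G q x.
Proof.
move=> oU dF dG FG; elim: q x => [|q IH] x Ux; first exact: FG.
apply: is_cderive_unique (dF q x Ux) _.
apply: is_cderive_near (dG q x Ux).
by near=> t; apply/esym/IH; near: t; exact: open_nbhs_nbhs.
Unshelve. all: end_near. Qed.

Lemma tower_derive1n (F : nat -> R -> R[i]) q :
  (forall b x, is_cderive (F b) x (F b.+1 x)) ->
  derive1n q (fun t => complex.Re (F 0 t)) = (fun t => complex.Re (F q t)) /\
  derive1n q (fun t => complex.Im (F 0 t)) = (fun t => complex.Im (F q t)).
Proof.
move=> dF; elim: q => [//|q [IHr IHi]].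
rewrite !derive1nS IHr IHi; split; apply/funext => x; rewrite derive1E.
- by rewrite (@derive_val _ _ _ _ _ _ _ (proj1 (dF q x))).
- by rewrite (@derive_val _ _ _ _ _ _ _ (proj2 (dF q x))).
Qed.

End TowerDerivative.

(** * Bounds on towers, uniform in the data *)

Section TowerBounds.
Context {R : realType}.
Implicit Types (p : R[i]) (T : nat -> R[i]) (A M eps : R).
Local Notation normc := (@Normc.normc R).

Lemma normc_binomial_sum Q (V : nat -> R[i]) (M : R) :
  (forall b, (b <= Q)%N -> normc (V b) <= M) ->
  normc (\sum_(b < Q.+1) 'C(Q, b)%:R * V b) <= 2 ^+ Q * M.
Proof.
move=> VM; apply: le_trans (normc_sum _ _ _) _.
have -> : 2 ^+ Q * M = \sum_(b < Q.+1) 'C(Q, b)%:R * M.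
  rewrite -mulr_suml -natr_sum; congr (_ * _).
  rewrite -[2]/(1 + 1 :> R) exprDn natr_sum; apply: eq_bigr => i _.
  by rewrite !expr1n mul1r.
apply: ler_sum => b _; rewrite Normc.normcM normc_nat ler_wpM2l//.
by apply: VM; rewrite -ltnS.
Qed.

(** Each step multiplies an earlier entry by one T, bounded by A, and the binomial weights sum to
    2^Q; A >= 1 lets A^b be replaced by A^Q. That C depends on Q alone makes the later estimates
    uniform in n. *)
Lemma log_tower_bound Q : exists2 C : R, 0 <= C & forall p T A M, 1 <= A ->
  normc p <= M -> (forall b, (b < Q)%N -> normc (T b) <= A) ->
  forall q, (q <= Q)%N -> normc (log_tower p T q) <= C * A ^+ q * M.
Proof.
elim: Q => [|Q [C C0 IH]].
  exists 1 => // p T A M _ pM _ q; rewrite leqn0 => /eqP ->.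
  by rewrite expr0 !mul1r.
exists (C + 2 ^+ Q * C) => [|p T A M A1 pM TA q]; first by rewrite addr_ge0// mulr_ge0.
have A0 : 0 <= A by apply: le_trans A1.
have M0 : 0 <= M by apply: le_trans pM; exact: normc_ge0.
have {}IH b : (b <= Q)%N -> normc (log_tower p T b) <= C * A ^+ b * M.
  by apply: IH => // b' b'Q; apply: TA; exact: ltnW.
rewrite leq_eqVlt => /predU1P[->|]; last first.
  rewrite ltnS => /IH /le_trans; apply; rewrite ler_wpM2r// ler_wpM2r ?exprn_ge0//.
  by rewrite lerDl mulr_ge0.
rewrite log_towerS.
apply: (@le_trans _ _ (2 ^+ Q * (C * A ^+ Q * M * A))).
  apply: (@normc_binomial_sum _ (fun b => log_tower p T b * T (Q - b)%N)) => b bQ.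
  rewrite Normc.normcM; apply: ler_pM; rewrite ?normc_ge0//; last first.
    by apply: TA; rewrite ltnS leq_subr.
  apply: le_trans (IH _ bQ) _.
  by rewrite ler_wpM2r// ler_wpM2l// ler_weXn2l.
rewrite (_ : 2 ^+ Q * _ = 2 ^+ Q * C * A ^+ Q.+1 * M); last by rewrite exprS; ring.
by rewrite ler_wpM2r// ler_wpM2r ?exprn_ge0// lerDr.
Qed.

(** Each product P_b T - P'_b T' is split as (P_b - P'_b) T + P'_b (T - T'): the induction bounds
    the first part, [log_tower_bound] the second. *)
Lemma log_tower_diff Q : exists2 C : R, 0 <= C & forall p p' T T' A M eps,
  1 <= A -> 0 <= eps ->
  normc p <= M -> normc p' <= M -> normc (p - p') <= eps * M ->
  (forall b, (b < Q)%N -> normc (T b) <= A) ->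
  (forall b, (b < Q)%N -> normc (T' b) <= A) ->
  (forall b, (b < Q)%N -> normc (T b - T' b) <= eps) ->
  forall q, (q <= Q)%N ->
    normc (log_tower p T q - log_tower p' T' q) <= C * eps * A ^+ q * M.
Proof.
elim: Q => [|Q [C C0 IH]].
  exists 1 => // p p' T T' A M eps _ _ _ _ pp' _ _ _ q; rewrite leqn0 => /eqP ->.
  by rewrite expr0 mulr1 mul1r.
have [C1 C10 bd] := log_tower_bound Q.
exists (C + 2 ^+ Q * (C + C1)) => [|p p' T T' A M eps A1 e0 pM p'M pp' TA T'A TT' q].
  by rewrite addr_ge0// mulr_ge0// addr_ge0.
have A0 : 0 <= A by apply: le_trans A1.
have M0 : 0 <= M by apply: le_trans pM; exact: normc_ge0.
have {}IH b : (b <= Q)%N ->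
    normc (log_tower p T b - log_tower p' T' b) <= C * eps * A ^+ b * M.
  by apply: IH => // b' b'Q; [apply: TA|apply: T'A|apply: TT']; exact: ltnW.
rewrite leq_eqVlt => /predU1P[->|]; last first.
  rewrite ltnS => /IH /le_trans; apply; rewrite ler_wpM2r// ler_wpM2r ?exprn_ge0//.
  by rewrite ler_wpM2r// lerDl mulr_ge0// addr_ge0.
rewrite !log_towerS -sumrB.
under eq_bigr => b _ do rewrite -mulrBr.
apply: (@le_trans _ _ (2 ^+ Q * (C * eps * A ^+ Q * M * A + C1 * A ^+ Q * M * eps))).
  apply: (@normc_binomial_sum _ (fun b => log_tower p T b * T (Q - b)%N -
      log_tower p' T' b * T' (Q - b)%N)) => b bQ.
  rewrite (_ : _ - _ = (log_tower p T b - log_tower p' T' b) * T (Q - b)%N +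
     log_tower p' T' b * (T (Q - b)%N - T' (Q - b)%N)); last by ring.
  apply: le_trans (le_normcD _ _) _; rewrite !Normc.normcM.
  have QbQ : (Q - b < Q.+1)%N by rewrite ltnS leq_subr.
  apply: lerD; apply: ler_pM; rewrite ?normc_ge0 ?TA ?TT'//.
  - apply: le_trans (IH _ bQ) _.
    by rewrite ler_wpM2r// ler_wpM2l ?mulr_ge0// ler_weXn2l.
  - apply: le_trans (bd p' T' A M A1 p'M _ b bQ) _.
      by move=> b' b'Q; apply: T'A; exact: ltnW.
    by rewrite ler_wpM2r// ler_wpM2l// ler_weXn2l.
apply: (@le_trans _ _ (2 ^+ Q * (C + C1) * eps * A ^+ Q.+1 * M)); last first.
  rewrite ler_wpM2r// ler_wpM2r ?exprn_ge0//.
  by rewrite ler_wpM2r// lerDr.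
rewrite -!mulrA ler_wpM2l ?exprn_ge0// mulrDl lerD//.
  by rewrite exprS le_eqVlt; apply/orP; left; apply/eqP; ring.
rewrite exprS [leRHS](_ : _ = A * (C1 * (A ^+ Q * (M * eps)))); last by ring.
by rewrite ler_peMl// !mulr_ge0// exprn_ge0.
Qed.

End TowerBounds.

(** * Integrals of complex-valued functions *)

Section RealIntegral.
Context {R : realType}.
Local Notation mu := (@lebesgue_measure R).
Implicit Types (f g : R -> R).

Lemma measurable_shift (a : R) :
  measurable_fun [set: measurableTypeR R] (fun s : measurableTypeR R => (s : R) + a : measurableTypeR R).
Proof. by apply: measurable_funD. Qed.

(** The pushforward under a translation gives half-open intervals their length, and Lebesgue measure
    is the only measure that does. *)
Lemma lebesgue_measure_shift (a : R) (A : set R) : measurable A ->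
  pushforward mu (fun s : measurableTypeR R => (s : R) + a : measurableTypeR R) A = mu A.
Proof.
move=> mA; apply/esym/lebesgue_measure_unique => //=; first exact: measurable_shift.
move=> ms _ [[b c]] _ <-.
rewrite /pushforward (_ : _ @^-1` _ = `]b - a, c - a]%classic).
  rewrite !lebesgue_measure_itv/= !lte_fin ltrD2r; case: ifPn => // _.
  by rewrite -!EFinD; congr EFin; ring.
by apply/seteqP; split => s /=; rewrite !in_itv/= ltrBlDr lerBrDr.
Qed.

Lemma Rintegral_shift f (a : R) : measurable_fun setT f ->
  mu.-integrable setT (EFin \o f) ->
  \int[mu]_s f (s + a) = \int[mu]_s f s.
Proof.
move=> mf fi; congr fine.
have fai : mu.-integrable setT ((EFin \o f) \o (fun s : measurableTypeR R => (s : R) + a : measurableTypeR R)).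
  apply/integrableP; split.
    by apply/measurable_EFinP/measurableT_comp => //; exact: measurable_shift.
  have /integrableP[_] := fi; apply: le_lt_trans.
  rewrite -(@ge0_integral_pushforward _ _ _ _ _ _ (measurable_shift a) mu setT
    (fun s => `|(f s)%:E|%E))//.
    rewrite le_eqVlt; apply/orP; left; apply/eqP.
    apply: eq_measure_integral; first exact: measurable_shift.
    by move=> ms A mA _; exact: lebesgue_measure_shift.
  by apply: measurableT_comp => //; apply/measurable_EFinP.
have := @integral_pushforward _ _ _ _ _ _ (measurable_shift a) mu setT
  (EFin \o f) _ fai measurableT.
rewrite preimage_setT => <-; last exact/measurable_EFinP.
apply: eq_measure_integral; first exact: measurable_shift.
by move=> ms A mA _; exact: lebesgue_measure_shift.
Qed.

(** Multiples of this function dominate every integrand below. By symmetry the claim reduces to the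
    known integral over the half-line. *)
Lemma integrable_invDsqr : mu.-integrable setT (fun s : R => ((1 + s ^+ 2)^-1)%:E).
Proof.
have ge1 (s : R) : 1 <= 1 + s ^+ 2 by exact: oneDsqr_ge1.
have c : continuous (fun s : R => (1 + s ^+ 2)^-1) by exact: continuous_oneDsqrV.
have ge0 (s : R) : 0 <= (1 + s ^+ 2)^-1 by rewrite invr_ge0 (le_trans _ (ge1 s)).
apply/integrableP; split.
  by apply/measurable_EFinP; exact: continuous_measurable_fun.
under eq_integral do rewrite gee0_abs ?lee_fin//.
rewrite ge0_symfun_integralT//; last by move=> s /=; rewrite sqrrN.
by rewrite -set_itvcy integral0y_oneDsqr -EFinM ltry.
Qed.

Lemma le_integrable_continuous f g : continuous f ->
  (forall s, `|f s| <= g s) -> mu.-integrable setT (EFin \o g) ->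
  mu.-integrable setT (EFin \o f).
Proof.
move=> cf fg; apply: le_integrable => //.
  by apply/measurable_EFinP; exact: continuous_measurable_fun.
by move=> s _ /=; rewrite lee_fin (le_trans (fg s))// ler_norm.
Qed.

Lemma is_derive_Rintegral (f df : R -> R -> R) (G : R -> R) (a : R) :
  (forall x, mu.-integrable setT (EFin \o f x)) ->
  (forall x s : R, is_derive x 1 (f^~ s) (df x s)) ->
  mu.-integrable setT (EFin \o G) -> (forall x s, `|df x s| <= G s) ->
  is_derive a 1 (fun x => \int[mu]_s f x s) (\int[mu]_s df a s).
Proof.
move=> fi fd Gi dfG.
have G0 s : 0 <= G s by apply: le_trans (dfG 0 s).
have aI : `]a - 1, a + 1[%classic a by rewrite /= in_itv/=; apply/andP; split; lra.
have dfE (x s : R) : partial1of2 f x s = df x s.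
  by rewrite partial1of2E (@derive_val _ _ _ _ _ _ _ (fd x s)).
have derf (x s : R) : `]a - 1, a + 1[%classic x -> [set: R] s -> derivable (f^~ s) x 1.
  by move=> _ _; have [] := fd x s.
have Gub (x s : R) : `]a - 1, a + 1[%classic x -> [set: R] s -> `|partial1of2 f x s| <= G s.
  by move=> _ _; rewrite dfE.
apply: DeriveDef.
  exact: (derivable_under_integral measurableT aI (fun x _ => fi x) derf G0 Gi Gub).
rewrite -derive1E.
rewrite (differentiation_under_integral measurableT aI (fun x _ => fi x) derf G0 Gi Gub).
by apply: eq_Rintegral => s _; exact: dfE.
Qed.

End RealIntegral.

Section ComplexIntegral.
Context {R : realType}.
Local Notation mu := (@lebesgue_measure R).
Local Notation normc := (@Normc.normc R).
Implicit Types (F G : R -> R[i]) (a : R[i]).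

Definition cintegrable F : Prop :=
  mu.-integrable setT (fun s => (complex.Re (F s))%:E) /\
  mu.-integrable setT (fun s => (complex.Im (F s))%:E).

Definition cintegral F : R[i] :=
  (\int[mu]_s complex.Re (F s) +i* \int[mu]_s complex.Im (F s))%C.

Lemma cintegrableD F G : cintegrable F -> cintegrable G ->
  cintegrable (fun s => F s + G s).
Proof.
move=> [Fr Fi] [Gr Gi]; split.
- by under eq_fun do rewrite ReD EFinD; exact: integrableD.
- by under eq_fun do rewrite ImD EFinD; exact: integrableD.
Qed.

Lemma cintegralD F G : cintegrable F -> cintegrable G ->
  cintegral (fun s => F s + G s) = cintegral F + cintegral G.
Proof.
move=> [Fr Fi] [Gr Gi]; rewrite /cintegral.
rewrite [RHS](_ : _ = ((\int[mu]_s complex.Re (F s) + \int[mu]_s complex.Re (G s)) +i*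
   (\int[mu]_s complex.Im (F s) + \int[mu]_s complex.Im (G s)))%C)//.
by congr Complex; rewrite -RintegralD//; apply: eq_Rintegral => s _; rewrite ?ReD ?ImD.
Qed.

Lemma cintegrableZ a F : cintegrable F -> cintegrable (fun s => a * F s).
Proof.
move=> [Fr Fi]; split.
- under eq_fun do rewrite ReM EFinB !EFinM.
  by apply: integrableB => //; exact: integrableZl.
- under eq_fun do rewrite ImM EFinD !EFinM.
  by apply: integrableD => //; exact: integrableZl.
Qed.

Lemma cintegralZ a F : cintegrable F ->
  cintegral (fun s => a * F s) = a * cintegral F.
Proof.
move=> [Fr Fi]; rewrite /cintegral; case: a => a b.
rewrite [RHS](_ : _ = ((a * \int[mu]_s complex.Re (F s) - b * \int[mu]_s complex.Im (F s)) +i*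
   (a * \int[mu]_s complex.Im (F s) + b * \int[mu]_s complex.Re (F s)))%C)//.
have i1 (k : R) (f : R -> R) : mu.-integrable setT (EFin \o f) ->
    mu.-integrable setT (EFin \o (fun s => k * f s)).
  by move=> fi; rewrite /comp; under eq_fun do rewrite EFinM; exact: integrableZl.
congr Complex.
- rewrite -!RintegralZl// -RintegralB//; [|exact: i1..].
  by apply: eq_Rintegral => s _; rewrite ReM.
- rewrite -!RintegralZl// -RintegralD//; [|exact: i1..].
  by apply: eq_Rintegral => s _; rewrite ImM.
Qed.

Lemma cintegral0 : cintegral (fun=> 0) = 0.
Proof. by rewrite /cintegral/= /Rintegral integral0. Qed.

Lemma cintegrable_sum (n : nat) (F : 'I_n -> R -> R[i]) :
  (forall k, cintegrable (F k)) -> cintegrable (fun s => \sum_(k < n) F k s).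
Proof.
elim: n F => [|n IH] F Fi.
  by under eq_fun do rewrite big_ord0; split; exact: integrable0.
under eq_fun do rewrite big_ord_recr/=.
by apply: cintegrableD => //; apply: IH.
Qed.

Lemma cintegral_sum (n : nat) (F : 'I_n -> R -> R[i]) :
  (forall k, cintegrable (F k)) ->
  cintegral (fun s => \sum_(k < n) F k s) = \sum_(k < n) cintegral (F k).
Proof.
elim: n F => [|n IH] F Fi.
  by under eq_fun do rewrite big_ord0; rewrite big_ord0 cintegral0.
under eq_fun do rewrite big_ord_recr/=.
rewrite big_ord_recr/= cintegralD// ?IH//.
exact: (@cintegrable_sum n (fun i => F (widen_ord (leqnSn n) i))).
Qed.

Lemma cintegralB F G : cintegrable F -> cintegrable G ->
  cintegral (fun s => F s - G s) = cintegral F - cintegral G.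
Proof.
move=> Fi Gi; under eq_fun do rewrite -[- G _]mulN1r.
by rewrite cintegralD// ?cintegralZ ?mulN1r//; exact: cintegrableZ.
Qed.

Lemma cintegrableB F G : cintegrable F -> cintegrable G ->
  cintegrable (fun s => F s - G s).
Proof.
move=> Fi Gi; under eq_fun do rewrite -[- G _]mulN1r.
by apply: cintegrableD => //; exact: cintegrableZ.
Qed.

Lemma le_cintegrable F (g : R -> R) : (forall s, exists d, is_cderive F s d) ->
  (forall s, normc (F s) <= g s) -> mu.-integrable setT (EFin \o g) ->
  cintegrable F.
Proof.
move=> dF Fg gi.
have cF (f : R -> R) : (forall s : R, exists d : R, is_derive s 1 f d) -> continuous f.
  move=> df s; apply: differentiable_continuous; apply/derivable1_diffP.
  by have [d []] := df s.
split; apply: (@le_integrable_continuous _ _ g) => //.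
- by apply: cF => s; have [d [dr _]] := dF s; exists (complex.Re d).
- by move=> s; exact: le_trans (normr_Re_le _) (Fg s).
- by apply: cF => s; have [d [_ di]] := dF s; exists (complex.Im d).
- by move=> s; exact: le_trans (normr_Im_le _) (Fg s).
Qed.

(** The factor 2 comes from bounding the real and the imaginary part separately. *)
Lemma normc_cintegral_le F (g : R -> R) : cintegrable F ->
  (forall s, normc (F s) <= g s) -> mu.-integrable setT (EFin \o g) ->
  normc (cintegral F) <= 2 * \int[mu]_s g s.
Proof.
move=> [Fr Fi] Fg gi; apply: le_trans (normc_le_ReIm _) _.
have bd (f : R -> R) : mu.-integrable setT (EFin \o f) -> (forall s, `|f s| <= g s) ->
    `|\int[mu]_s f s| <= \int[mu]_s g s.
  move=> fi fg; apply: le_trans (le_normr_Rintegral _ fi) _ => //.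
  by apply: le_Rintegral => //; exact: integrable_norm.
rewrite mulr2n mulrDl mul1r; apply: lerD; apply: bd => // s.
- exact: le_trans (normr_Re_le _) (Fg s).
- exact: le_trans (normr_Im_le _) (Fg s).
Qed.

Lemma cintegral_shift F (a : R) : cintegrable F ->
  cintegral (fun s => F (s + a)) = cintegral F.
Proof.
move=> [Fr Fi]; congr Complex.
- apply: (@Rintegral_shift _ (fun s => complex.Re (F s))) => //.
  by apply/measurable_EFinP; exact: measurable_int Fr.
- apply: (@Rintegral_shift _ (fun s => complex.Im (F s))) => //.
  by apply/measurable_EFinP; exact: measurable_int Fi.
Qed.

Lemma is_cderive_cintegral (F dF : R -> R -> R[i]) (g : R -> R) x :
  (forall x, cintegrable (F x)) ->
  (forall x s, is_cderive (F^~ s) x (dF x s)) ->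
  mu.-integrable setT (EFin \o g) -> (forall x s, normc (dF x s) <= g s) ->
  is_cderive (fun x => cintegral (F x)) x (cintegral (dF x)).
Proof.
move=> Fi dFE gi dFg; split => /=.
- apply: (@is_derive_Rintegral _ (fun x s => complex.Re (F x s)) (fun x s => complex.Re (dF x s)) g) => //.
  + by move=> y; have [] := Fi y.
  + by move=> y s; have [] := dFE y s.
  + by move=> y s; exact: le_trans (normr_Re_le _) (dFg y s).
- apply: (@is_derive_Rintegral _ (fun x s => complex.Im (F x s)) (fun x s => complex.Im (dF x s)) g) => //.
  + by move=> y; have [] := Fi y.
  + by move=> y s; have [] := dFE y s.
  + by move=> y s; exact: le_trans (normr_Im_le _) (dFg y s).
Qed.

End ComplexIntegral.

(** * Interpolation and elementary inequalities *)

Section Lagrange.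
Context {K : fieldType} (n : nat) (y : 'I_n -> K).
Hypothesis y_inj : injective y.

Let node k : {poly K} := \prod_(j < n | j != k) ('X - (y j)%:P).

Let node_monic k : node k \is monic.
Proof. exact: monic_prod_XsubC. Qed.

Let size_node k : size (node k) = n.
Proof.
rewrite /node -big_filter size_prod_XsubC size_filter -sum1_count sum1_card.
by rewrite cardC1 card_ord prednK// (leq_ltn_trans _ (ltn_ord k)).
Qed.

(** The difference of the two sides has size at most n and vanishes at n distinct points. *)
Lemma lagrange_interpolation (p : {poly K}) : (size p <= n)%N ->
  p = \sum_(k < n) (p.[y k] / \prod_(j < n | j != k) (y k - y j)) *: node k.
Proof.
move=> sp; apply/eqP; rewrite -subr_eq0; apply/negPn/negP => q0.
set q := _ - _ in q0.
have sq : (size q <= n)%N.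
  apply: leq_trans (size_polyD _ _) _; rewrite size_polyN geq_max sp/=.
  apply: leq_trans (size_sum _ _ _) _; apply/bigmax_leqP => k _.
  by apply: leq_trans (size_scale_leq _ _) _; rewrite size_node.
have rq : all (root q) (codom y).
  apply/allP => _ /codomP[i ->]; rewrite /root /q hornerD hornerN horner_sum.
  rewrite (bigD1 i)//= [X in _ - (_ + X)]big1 => [|k ki]; last first.
    rewrite hornerZ /node horner_prod [X in _ * X](bigD1 i) ?(eq_sym i)//= hornerXsubC.
    by rewrite subrr mul0r mulr0.
  rewrite addr0 hornerZ /node horner_prod.
  under [X in _ / _ * X]eq_bigr do rewrite hornerXsubC.
  rewrite divfK ?subrr//; apply/prodf_neq0 => j ji.
  by rewrite subr_eq0 (inj_eq y_inj) eq_sym.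
have := max_poly_roots q0 rq.
rewrite /codom map_inj_uniq// enum_uniq size_map size_enum_ord => /(_ isT).
by rewrite ltnNge sq.
Qed.

(** Coefficients of degree n - 1 in Lagrange's formula, whose node polynomials are monic. For n > 1
    the choice p = 1 gives 0; the choice p = X^(n-1) gives 1. *)
Lemma sum_div_prod_sub (p : {poly K}) : (size p <= n)%N ->
  \sum_(k < n) p.[y k] / \prod_(j < n | j != k) (y k - y j) = p`_n.-1.
Proof.
move=> sp; rewrite [in RHS](lagrange_interpolation sp) coef_sum; apply: eq_bigr => k _.
rewrite coefZ; have /monicP := node_monic k.
by rewrite /lead_coef size_node => ->; rewrite mulr1.
Qed.

(** Lagrange's formula for the constant 1, evaluated at 0. The sign (-1)^(n-1) from the node
    polynomial at 0 cancels the one from reversing the differences. *)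
Lemma partial_fractions : (0 < n)%N -> (forall k, y k != 0) ->
  (\prod_(k < n) y k)^-1 = \sum_(k < n) (\prod_(j < n | j != k) (y j - y k))^-1 / y k.
Proof.
move=> n0 y0; have s1 : (size (1%:P : {poly K}) <= n)%N by rewrite size_polyC oner_eq0.
have /(congr1 (fun p : {poly K} => p.[0])) := lagrange_interpolation s1.
rewrite hornerC horner_sum => e; rewrite -[LHS]mul1r [X in X * _]e mulr_suml.
apply: eq_bigr => k _; rewrite hornerZ hornerC.
set sgn := \prod_(j < n | j != k) (-1 : K).
have -> : \prod_(j < n | j != k) (y k - y j) = sgn * \prod_(j < n | j != k) (y j - y k).
  by rewrite /sgn -big_split/=; apply: eq_bigr => j _; rewrite mulN1r opprB.
have -> : (node k).[0] = sgn * \prod_(j < n | j != k) y j.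
  rewrite /node horner_prod /sgn -big_split/=; apply: eq_bigr => j _.
  by rewrite hornerXsubC sub0r mulN1r.
have sgn0 : sgn != 0 by apply/prodf_neq0 => j _; rewrite oppr_eq0 oner_eq0.
have A0 : \prod_(j < n | j != k) (y j - y k) != 0.
  by apply/prodf_neq0 => j jk; rewrite subr_eq0 (inj_eq y_inj).
have B0 : \prod_(j < n | j != k) y j != 0 by apply/prodf_neq0 => j _; exact: y0.
have -> : \prod_(j < n) y j = y k * \prod_(j < n | j != k) y j by rewrite (bigD1 k).
by field; rewrite y0 sgn0 A0 B0.
Qed.

End Lagrange.

(** * Convexity, Taylor bounds and the comparison of one factor with a Gaussian *)

Section RealInequalities.
Context {R : realType}.
Implicit Types (u t y : R).

(** The exponential lies below its chord over [0, L]: the tangent at theta L bounds the values at L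
    and at 0 from below, and these two bounds are averaged with weights theta and 1 - theta. *)
Lemma expR_convex (theta L : R) : 0 <= theta <= 1 ->
  expR (theta * L) <= 1 + theta * (expR L - 1).
Proof.
move=> /andP[t0 t1]; set M := expR _.
have M0 : 0 < M by exact: expR_gt0.
have h1 : M * (1 + (L - theta * L)) <= expR L.
  rewrite -[leRHS](_ : M * expR (L - theta * L) = _); last first.
    by rewrite -expRD; congr expR; ring.
  by apply: ler_wpM2l; [exact: ltW|exact: expR_ge1Dx].
have h2 : M * (1 - theta * L) <= 1.
  rewrite -[leRHS](_ : M * expR (- (theta * L)) = _); last first.
    by rewrite -expRD subrr expR0.
  by apply: ler_wpM2l; [exact: ltW|exact: expR_ge1Dx].
have t1' : 0 <= 1 - theta by rewrite subr_ge0.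
have := lerD (ler_wpM2l t0 h1) (ler_wpM2l t1' h2).
rewrite [leLHS](_ : _ = M); last by ring.
by move=> /le_trans; apply; rewrite le_eqVlt; apply/orP; left; apply/eqP; ring.
Qed.

(** On [0, y] with y = W / K, ln (1 + a) lies above its chord (a / y) ln (1 + y), and the a_k / y
    sum to K. So many small factors do at least as well as K factors 1 + y, which is where decay of
    prescribed order comes from. *)
Lemma prod_1D_ge (n K : nat) (a : 'I_n -> R) (W : R) : (0 < K)%N ->
  (forall k, 0 <= a k <= W / K%:R) -> \sum_(k < n) a k = W ->
  (1 + W / K%:R) ^+ K <= \prod_(k < n) (1 + a k).
Proof.
move=> K0 aW sa.
have [->|W0] := eqVneq W 0.
  rewrite mul0r addr0; have -> : 1 ^+ K = \prod_(k < n) (1 : R) by rewrite expr1n big1_eq.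
  by apply: ler_prod => k _; rewrite ler01 lerDl; have /andP[] := aW k.
have KR : 0 < K%:R :> R by rewrite ltr0n.
have y0 : 0 < W / K%:R.
  rewrite divr_gt0// lt_neqAle eq_sym W0 -sa sumr_ge0// => k _.
  by have /andP[] := aW k.
set y := W / K%:R in aW y0 *.
have Ly : expR (ln (1 + y)) = 1 + y by rewrite lnK// posrE addr_gt0.
rewrite -{1}Ly -expRM_natl.
have -> : K%:R * ln (1 + y) = \sum_(k < n) a k / y * ln (1 + y).
  rewrite -mulr_suml -mulr_suml sa /y invf_div; congr (_ * _).
  by rewrite mulrCA mulfV ?mulr1.
rewrite expR_sum; apply: ler_prod => k _; rewrite expR_ge0/=.
have /andP[a0 ay] := aW k.
have := @expR_convex (a k / y) (ln (1 + y)).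
rewrite divr_ge0 ?(ltW y0)// ler_pdivrMr// mul1r ay => /(_ isT).
by rewrite Ly [1 + y]addrC addrK divfK// gt_eqF.
Qed.

(** The mean value theorem; a factor 1 / (n + 1) is given away. Four applications, each feeding the
    next, yield the Taylor bounds for sin and cos below. *)
Lemma normr_le_of_derive (n : nat) (f df : R -> R) :
  (forall t : R, is_derive t 1 f (df t)) -> f 0 = 0 ->
  (forall t, `|df t| <= `|t| ^+ n) -> forall u, `|f u| <= `|u| ^+ n.+1.
Proof.
move=> dfE f0 dfn u.
have cf : continuous f.
  by move=> s; apply: differentiable_continuous; apply/derivable1_diffP.
have mvt (a b : R) : a <= b -> exists2 c : R, c \in `[a, b]%R & f b - f a = df c * (b - a).
  move=> ab; apply: (@MVT_segment _ f df a b ab).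
  exact: continuous_subspaceT.
suff [c cu fuE] : exists2 c : R, `|c| <= `|u| & f u = df c * u.
  rewrite fuE normrM exprSr ler_wpM2r// (le_trans (dfn c))// lerXn2r ?nnegrE//.
have [u0|u0] := leP 0 u.
- have [c] := mvt _ _ u0; rewrite f0 !subr0 in_itv/= => /andP[c0 cu] ->.
  by exists c => //; rewrite !ger0_norm.
- have [c] := mvt _ _ (ltW u0); rewrite f0 !sub0r in_itv/= mulrN => /andP[uc c0] /oppr_inj ->.
  by exists c => //; rewrite !ler0_norm ?lerN2// ltW.
Qed.

Lemma normr_sin_le u : `|sin u| <= `|u|.
Proof.
rewrite -[leRHS]expr1; apply: (@normr_le_of_derive 0 sin cos); rewrite ?sin0// => t.
by rewrite expr0 ler_norml cos_geN1 cos_le1.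
Qed.

Lemma normr_cosB1_le u : `|cos u - 1| <= `|u| ^+ 2.
Proof.
apply: (@normr_le_of_derive 1 (fun t => cos t - 1) (fun t => - sin t)) => [t||t].
- have -> : (fun t => cos t - 1) = cos + cst (-1) :> (R -> R) by [].
  by apply: is_derive_eq; rewrite ?oppr0 ?addr0 ?subr0.
- by rewrite cos0 subrr.
- by rewrite normrN expr1 normr_sin_le.
Qed.

Lemma normr_sinBid_le u : `|sin u - u| <= `|u| ^+ 3.
Proof.
apply: (@normr_le_of_derive 2 (fun t => sin t - t) (fun t => cos t - 1)) => [|t].
- by rewrite sin0 subrr.
- exact: normr_cosB1_le.
Qed.

Lemma normr_cosB1D_le u : `|cos u - 1 + u ^+ 2 / 2| <= `|u| ^+ 4.
Proof.
apply: (@normr_le_of_derive 3 (fun t => cos t - 1 + t ^+ 2 / 2) (fun t => t - sin t)) => [t||t].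
- have -> : (fun t => cos t - 1 + t ^+ 2 / 2) = cos + cst (-1) + (id * id) * cst (1/2) :> (R -> R).
    by apply/funext => s; rewrite !fctE/= mul1r expr2.
  have dcos := is_deriveD (is_derive_cos t) (is_derive_cst (-1 : R) t (1 : R)).
  have dsqr := is_deriveM (is_derive_id t (1 : R)) (is_derive_id t (1 : R)).
  have dhalf := is_derive_cst (1 / 2 : R) t (1 : R).
  have h := is_deriveD dcos (is_deriveM dsqr dhalf).
  by apply: (is_derive_eq h); rewrite /GRing.scale/=; lra.
- by rewrite cos0 subrr expr0n mul0r addr0.
- by rewrite distrC normr_sinBid_le.
Qed.

(** With y = u^2 / 2: exp(-y) <= 1 / (1 + y), and (1 - y + y^2) (1 + y) = 1 + y^3 >= 1. *)
Lemma gauss_bounds u : 1 - u ^+ 2 / 2 <= gauss u <= 1 - u ^+ 2 / 2 + (u ^+ 2 / 2) ^+ 2.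
Proof.
rewrite /gauss; set y := u ^+ 2 / 2.
have y0 : 0 <= y by rewrite divr_ge0// sqr_ge0.
rewrite expR_ge1Dx/= expRN.
have h : 1 + y <= expR y by exact: expR_ge1Dx.
apply: (@le_trans _ _ (1 + y)^-1).
  by rewrite lef_pV2 ?posrE ?expR_gt0// ltr_pwDl.
rewrite -div1r ler_pdivrMr ?ltr_pwDl//.
rewrite (_ : _ * _ = 1 + y ^+ 3); last by ring.
by rewrite lerDl exprn_ge0.
Qed.

Lemma gauss_gt0 u : 0 < gauss u.
Proof. exact: expR_gt0. Qed.

Lemma gauss_le1 u : gauss u <= 1.
Proof. by rewrite /gauss -expR0 ler_expR oppr_le0 divr_ge0// sqr_ge0. Qed.

(** Squared, this is 1 + u^2 <= exp(u^2). It gives the Gaussian factors the same majorant 1 / |1 + i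
    u| as the factors of the integrand. *)
Lemma gauss_le_inv_sqrt u : gauss u <= (Num.sqrt (1 + u ^+ 2))^-1.
Proof.
have p : 0 < 1 + u ^+ 2 by rewrite ltr_pwDl// sqr_ge0.
rewrite -(@ler_pXn2r _ 2) ?nnegrE ?(ltW (gauss_gt0 u)) ?invr_ge0 ?sqrtr_ge0//.
rewrite exprVn sqr_sqrtr ?(ltW p)// /gauss -expRM_natl.
rewrite (_ : _ * _ = - u ^+ 2); last by field.
by rewrite expRN lef_pV2 ?posrE ?expR_gt0// expR_ge1Dx.
Qed.

(** Since i u - log (1 + i u) = - u^2 / 2 + O(u^3), the two sides agree to third order. For |u| >= 1
    both terms are at most 1 in modulus. For |u| < 1 the denominator is cleared and the components
    give 5/4 + 3/2 <= 3. *)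
Lemma cis_sub_gauss u :
  Normc.normc (cis u / (1 + 'i%C * (u%:C)%C) - (gauss u)%:C%C) <= 3 * `|u| ^+ 3.
Proof.
have zE : 1 + 'i%C * (u%:C)%C = (1 +i* u)%C :> R[i].
  by apply/eqP; rewrite eq_complex/=; apply/andP; split; apply/eqP; ring.
have z1 : 1 <= Normc.normc (1 + 'i%C * (u%:C)%C : R[i]).
  rewrite zE/= -[leLHS]sqrtr1; apply: ler_wsqrtr.
  by rewrite expr1n lerDl sqr_ge0.
have z0 : 1 + 'i%C * (u%:C)%C != 0 :> R[i].
  by apply: contraTneq z1 => ->; rewrite Normc.normc0 -ltNge ltr01.
have gu0 := gauss_gt0 u.
have gu1 := gauss_le1 u.
have [u1|u1] := leP 1 `|u|.
  apply: le_trans (le_normcB _ _) _.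
  rewrite Normc.normcM normc_cis Normc.normcV mul1r normcR (ger0_norm (ltW gu0)).
  have : (Normc.normc (1 + 'i%C * (u%:C)%C : R[i]))^-1 <= 1 by rewrite invf_le1 ?(lt_le_trans _ z1).
  have : 1 <= `|u| ^+ 3 by rewrite exprn_ege1.
  lra.
rewrite (_ : _ - _ = (cis u - (1 + 'i%C * (u%:C)%C) * (gauss u)%:C%C) / (1 + 'i%C * (u%:C)%C)); last first.
  by field.
rewrite Normc.normcM Normc.normcV.
apply: (@le_trans _ _ (Normc.normc (cis u - (1 + 'i%C * (u%:C)%C) * (gauss u)%:C%C))).
  by rewrite ler_piMr ?normc_ge0// invf_le1 ?(lt_le_trans _ z1).
apply: le_trans (normc_le_ReIm _) _.
rewrite zE [complex.Re _](_ : _ = cos u - gauss u); last by rewrite /=; ring.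
rewrite [complex.Im _](_ : _ = sin u - u * gauss u); last by rewrite /=; ring.
have /andP[g1 g2] := gauss_bounds u.
have c4 := normr_cosB1D_le u.
have s3 := normr_sinBid_le u.
have au : 0 <= `|u| by [].
have u2 : u ^+ 2 = `|u| ^+ 2 by rewrite real_normK ?num_real.
move: (gauss u) g1 g2 gu0 gu1 => g g1 g2 g0 gg1.
have h1 : `|cos u - g| <= `|u| ^+ 4 + `|u| ^+ 4 / 4.
  rewrite (_ : cos u - g = (cos u - 1 + u ^+ 2 / 2) - (g - (1 - u ^+ 2 / 2))); last by ring.
  apply: le_trans (ler_normB _ _) _; apply: lerD => //.
  have g10 : 0 <= g - (1 - u ^+ 2 / 2) by rewrite subr_ge0.
  rewrite (ger0_norm g10) u2; rewrite u2 in g2.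
  by move: g2; rewrite !expr2; lra.
have h2 : `|sin u - u * g| <= `|u| ^+ 3 + `|u| ^+ 3 / 2.
  rewrite (_ : sin u - u * g = (sin u - u) + u * (1 - g)); last by ring.
  apply: le_trans (ler_normD _ _) _; apply: lerD => //.
  have g10 : 0 <= 1 - g by rewrite subr_ge0.
  rewrite normrM (ger0_norm g10).
  rewrite (exprS _ 2) -mulrA; apply: ler_wpM2l => //; rewrite -u2; lra.
have h3 : `|u| ^+ 4 <= `|u| ^+ 3 by rewrite exprSr ler_piMr ?exprn_ge0// ltW.
apply: le_trans (lerD h1 h2) _.
have h4 : 0 <= `|u| ^+ 3 by rewrite exprn_ge0.
move: (`|u| ^+ 4) (`|u| ^+ 3) h3 h4 => a4 a3; lra.
Qed.

End RealInequalities.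

(** * The integrand and its derivatives *)

Section Integrand.
Context {R : realType} (n : nat) (x : 'I_n -> R).
Local Notation normc := (@Normc.normc R).
Local Notation c := (Num.sqrt (n%:R : R))^-1.

Definition lin (xi s : R) (k : 'I_n) : R := xi * x k + c * s.

Definition fac (xi s : R) (k : 'I_n) : R[i] := 1 + 'i%C * ((lin xi s k)%:C)%C.

(** The function P of the overview; sqrt n is written n c because the phase then appears as the sum
    of the [lin xi s k]. *)
Definition integrand (xi s : R) : R[i] :=
  cis (n%:R * c * s) * \prod_(k < n) (fac xi s k)^-1.

(* The b-th derivative in xi of the logarithmic derivative of [integrand]. *)
Definition log_der (b : nat) (xi s : R) : R[i] :=
  b`!%:R * \sum_(k < n) (- 'i%C * ((x k)%:C)%C / fac xi s k) ^+ b.+1.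

Definition integrand_der (q : nat) (xi s : R) : R[i] :=
  log_tower (integrand xi s) (fun b => log_der b xi s) q.

Lemma facE xi s k : fac xi s k = (1 +i* lin xi s k)%C.
Proof. by apply/eqP; rewrite eq_complex/=; apply/andP; split; apply/eqP; ring. Qed.

Lemma normc_fac xi s k : normc (fac xi s k) = Num.sqrt (1 + lin xi s k ^+ 2).
Proof. by rewrite facE/= expr1n. Qed.

Lemma normc_fac_ge1 xi s k : 1 <= normc (fac xi s k).
Proof.
rewrite normc_fac -[leLHS]sqrtr1; apply: ler_wsqrtr.
by rewrite lerDl sqr_ge0.
Qed.

Lemma fac_neq0 xi s k : fac xi s k != 0.
Proof.
by apply: contraTneq (normc_fac_ge1 xi s k) => ->; rewrite Normc.normc0 -ltNge ltr01.
Qed.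

Lemma is_cderive_fac1 s k xi : is_cderive (fun t => fac t s k) xi ('i%C * ((x k)%:C)%C).
Proof.
rewrite -[X in is_cderive _ _ X]add0r; apply: is_cderiveD; first exact: is_cderive_cst.
apply: is_cderiveZ; apply: is_cderive_real.
have -> : (fun t => lin t s k) = (fun t => c * s + x k * t).
  by apply/funext => t; rewrite /lin addrC [t * _]mulrC.
exact: is_derive_affine.
Qed.

Lemma is_cderive_fac2 xi k s : is_cderive (fun t => fac xi t k) s ('i%C * (c%:C)%C).
Proof.
rewrite -[X in is_cderive _ _ X]add0r; apply: is_cderiveD; first exact: is_cderive_cst.
apply: is_cderiveZ; apply: is_cderive_real.
exact: is_derive_affine.
Qed.

Lemma is_cderive_integrand1 s xi :
  is_cderive (fun t => integrand t s) xi (integrand xi s * log_der 0 xi s).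
Proof.
rewrite /log_der fact0 mul1r /integrand -[X in is_cderive _ _ X]mulrA; apply: is_cderiveZ.
under [X in is_cderive _ _ (_ * X)]eq_bigr do rewrite expr1.
apply: (@is_cderive_prod _ n (fun k t => (fac t s k)^-1)) => k.
have := is_cderiveV (fac_neq0 xi s k) (is_cderive_fac1 s k xi).
congr is_cderive; have := fac_neq0 xi s k; move: (fac xi s k) => z z0.
by field.
Qed.

(** Each t = - i x_k / (1 + i u_k) satisfies t' = t^2, so (t^(b+1))' = (b + 1) t^(b+2); the
    factorial in [log_der] collects these factors. *)
Lemma is_cderive_log_der1 b s xi :
  is_cderive (fun t => log_der b t s) xi (log_der b.+1 xi s).
Proof.
rewrite [X in is_cderive _ _ X](_ : _ = b`!%:R * (b.+1%:R *
    \sum_(k < n) (- 'i%C * ((x k)%:C)%C / fac xi s k) ^+ b.+2)); last first.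
  by rewrite /log_der factS natrM -mulrA mulrCA.
apply: is_cderiveZ; rewrite mulr_sumr; apply: is_cderive_sum => k.
have := is_cderiveX b.+1 (is_cderiveZ (- 'i%C * ((x k)%:C)%C)
  (is_cderiveV (fac_neq0 xi s k) (is_cderive_fac1 s k xi))).
congr is_cderive; rewrite /= [in RHS]exprS [in RHS]exprS.
have := fac_neq0 xi s k; move: (fac xi s k) => z z0; move: (_ ^+ b) => e.
by field.
Qed.

Lemma is_cderive_integrand_der1 q s xi :
  is_cderive (fun t => integrand_der q t s) xi (integrand_der q.+1 xi s).
Proof.
apply: (@is_cderive_log_tower _ (fun t => integrand t s) (fun b t => log_der b t s)).
- exact: is_cderive_integrand1.
- by move=> b; exact: is_cderive_log_der1.
Qed.

Lemma cderivable_integrand_der2 q xi s :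
  exists d, is_cderive (fun t => integrand_der q xi t) s d.
Proof.
apply: (@cderivable_log_tower _ (fun t => integrand xi t) (fun b t => log_der b xi t)).
- have dinv k := is_cderiveV (fac_neq0 xi s k) (is_cderive_fac2 xi k s).
  have dl : is_derive s 1 (fun t => n%:R * c * t) (n%:R * c).
    have -> : (fun t => n%:R * c * t) = (fun t => 0 + n%:R * c * t).
      by apply/funext => t; rewrite add0r.
    exact: is_derive_affine.
  eexists; apply: is_cderiveM; first exact: is_cderive_cis dl.
  apply: (@is_cderive_prod _ n (fun k t => (fac xi t k)^-1)
    (fun k => - 'i%C * (c%:C)%C / fac xi s k)) => k.
  have := dinv k; congr is_cderive; have := fac_neq0 xi s k; move: (fac xi s k) => z z0.
  by move: (c%:C)%C => cc; field.
- move=> b; eexists; apply: is_cderiveZ; apply: is_cderive_sum => k.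
  apply: is_cderiveX; apply: is_cderiveZ.
  exact: is_cderiveV (fac_neq0 xi s k) (is_cderive_fac2 xi k s).
Qed.

End Integrand.

(** * The tower of the Gaussian *)

Section GaussTower.
Context {R : realType}.

Definition gauss_log_der (b : nat) (xi : R) : R[i] :=
  match b with 0 => ((- xi)%:C)%C | 1 => -1 | _ => 0 end.

Definition gauss_der (q : nat) (xi : R) : R[i] :=
  log_tower ((gauss xi)%:C)%C (fun b => gauss_log_der b xi) q.

Lemma is_cderive_gauss_der q xi : is_cderive (gauss_der q) xi (gauss_der q.+1 xi).
Proof.
apply: (@is_cderive_log_tower _ (fun t => ((gauss t)%:C)%C) gauss_log_der).
- rewrite /gauss_log_der/= -(rmorphM (real_complex R)); apply: is_cderive_real.
  rewrite /gauss.
  have h : is_derive xi 1 (fun t : R => - (t ^+ 2 / 2)) (- xi).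
    have -> : (fun t : R => - (t ^+ 2 / 2)) = - (id ^+ 2 * cst (1 / 2)) :> (R -> R).
      by apply/funext => t; rewrite !fctE/= mul1r.
    by apply: is_derive_eq; rewrite /GRing.scale/=; lra.
  exact: (@is_derive1_comp _ expR (fun t : R => - (t ^+ 2 / 2)) _ _ _ (is_derive_expR _) h).
- case=> [|[|b]] /=; last 2 first.
  + exact: is_cderive_cst.
  + exact: is_cderive_cst.
  rewrite (_ : -1 = ((-1 : R)%:C)%C); last by rewrite rmorphN1.
  by apply: is_cderive_real; exact: is_deriveN.
Qed.

(** Links the tower to the iterated derivative in the definition of [He]. *)
Lemma gauss_derE q xi : gauss_der q xi = ((derive1n q (@gauss R) xi)%:C)%C.
Proof.
have [hr hi] := tower_derive1n q is_cderive_gauss_der.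
rewrite [LHS](_ : _ = (complex.Re (gauss_der q xi) +i* complex.Im (gauss_der q xi))%C); last by case: (gauss_der q xi).
have := congr1 (@^~ xi) hr; have := congr1 (@^~ xi) hi; rewrite /= => <- <-.
congr Complex.
have -> : derive1n q (cst (0 : R)) = cst 0; last by [].
elim: q {hr hi} => [//|q IH]; rewrite derive1nS IH; apply/funext => t.
by rewrite derive1_cst.
Qed.

End GaussTower.

(** * Pointwise estimates *)

(** Telescoping. The errors are taken relative to the majorants rho, so that every term keeps the
    full product of the rho instead of losing one factor. *)
Lemma normc_prodB (R : realType) (n : nat) (a b : 'I_n -> R[i]) (rho e : 'I_n -> R) :
  (forall k, 0 <= e k) ->
  (forall k, Normc.normc (a k) <= rho k) -> (forall k, Normc.normc (b k) <= rho k) ->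
  (forall k, Normc.normc (a k - b k) <= e k * rho k) ->
  Normc.normc (\prod_(k < n) a k - \prod_(k < n) b k) <=
  (\sum_(k < n) e k) * \prod_(k < n) rho k.
Proof.
elim: n a b rho e => [|n IH] a b rho e e0 ar br ab.
  by rewrite !big_ord0 subrr Normc.normc0 mul0r.
rewrite !big_ord_recr/=.
set pa := \prod_(i < n) a _; set pb := \prod_(i < n) b _; set pr := \prod_(i < n) rho _.
set se := \sum_(i < n) e _.
have rho0 k : 0 <= rho k by apply: le_trans (ar k); exact: normc_ge0.
have -> : pa * a ord_max - pb * b ord_max =
    (pa - pb) * a ord_max + pb * (a ord_max - b ord_max) by ring.
apply: le_trans (le_normcD _ _) _; rewrite !Normc.normcM.
have h1 : Normc.normc (pa - pb) <= se * pr by exact: IH.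
have h2 : Normc.normc pb <= pr.
  by rewrite normc_prod; apply: ler_prod => k _; rewrite normc_ge0/=.
apply: (@le_trans _ _ (se * pr * rho ord_max + pr * (e ord_max * rho ord_max))).
  by apply: lerD; apply: ler_pM; rewrite ?normc_ge0.
by rewrite le_eqVlt; apply/orP; left; apply/eqP; ring.
Qed.

Section Estimates.
Context {R : realType} (n : nat) (x : 'I_n -> R).
Local Notation normc := (@Normc.normc R).
Local Notation c := (Num.sqrt (n%:R : R))^-1.
Local Notation B xi s := (1 + (xi ^+ 2 + s ^+ 2)).

Hypothesis n_gt0 : (0 < n)%N.
Hypothesis sum_x : \sum_(k < n) x k = 0.
Hypothesis sum_x2 : \sum_(k < n) x k ^+ 2 = 1.

Definition vlen (k : 'I_n) : R := Num.sqrt (x k ^+ 2 + c ^+ 2).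

Definition vcube : R := \sum_(k < n) vlen k ^+ 3.

Definition decay (xi s : R) : R := \prod_(k < n) (normc (fac x xi s k))^-1.

Lemma sqr_c : c ^+ 2 = n%:R^-1.
Proof. by rewrite exprVn sqr_sqrtr. Qed.

Lemma sqr_vlen k : vlen k ^+ 2 = x k ^+ 2 + c ^+ 2.
Proof. by rewrite sqr_sqrtr// addr_ge0// sqr_ge0. Qed.

Lemma vlen_ge0 k : 0 <= vlen k. Proof. exact: sqrtr_ge0. Qed.

Lemma vcube_ge0 : 0 <= vcube.
Proof. by apply: sumr_ge0 => k _; rewrite exprn_ge0// vlen_ge0. Qed.

Lemma normr_x_le k : `|x k| <= vlen k.
Proof. by rewrite -sqrtr_sqr; apply: ler_wsqrtr; rewrite lerDl sqr_ge0. Qed.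

Lemma sum_sqr_vlen : \sum_(k < n) vlen k ^+ 2 = 2.
Proof.
under eq_bigr do rewrite sqr_vlen.
rewrite big_split/= sum_x2 sumr_const card_ord sqr_c -[_^-1 *+ n]mulr_natl mulfV//.
by rewrite pnatr_eq0 -lt0n.
Qed.

(** One factor |v_k| is bounded by t; the squares of the others sum to 2. *)
Lemma vcube_le (t : R) : (forall k, vlen k <= t) -> vcube <= t * 2.
Proof.
move=> vt; rewrite -sum_sqr_vlen mulr_sumr; apply: ler_sum => k _.
by rewrite exprS ler_wpM2r// exprn_ge0// vlen_ge0.
Qed.

Lemma sum_lin xi s : \sum_(k < n) lin x xi s k = n%:R * c * s.
Proof.
rewrite big_split/= -mulr_sumr sum_x mulr0 add0r sumr_const card_ord.
by rewrite -[_ * s *+ n]mulr_natl mulrA.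
Qed.

(** The hypotheses on x say that the matrices v_k v_k^T sum to the identity, and u_k is the scalar
    product of v_k with (xi, s). *)
Lemma sum_sqr_lin xi s : \sum_(k < n) lin x xi s k ^+ 2 = xi ^+ 2 + s ^+ 2.
Proof.
rewrite (eq_bigr (fun k => xi ^+ 2 * x k ^+ 2 + 2 * xi * (c * s) * x k + c ^+ 2 * s ^+ 2)).
  rewrite !big_split/= -!mulr_sumr sum_x sum_x2 mulr0 addr0 mulr1; congr (_ + _).
  rewrite sumr_const card_ord sqr_c -[s *+ n]mulr_natl; field.
  by rewrite pnatr_eq0 -lt0n.
by move=> k _; rewrite /lin; ring.
Qed.

Lemma sum_mul_x_lin xi s : \sum_(k < n) x k * lin x xi s k = xi.
Proof.
rewrite (eq_bigr (fun k => xi * x k ^+ 2 + c * s * x k)).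
  by rewrite !big_split/= -!mulr_sumr sum_x sum_x2 mulr0 addr0 mulr1.
by move=> k _; rewrite /lin; ring.
Qed.

Lemma B_ge1 (xi s : R) : 1 <= B xi s.
Proof. by rewrite lerDl addr_ge0// sqr_ge0. Qed.

Lemma normr_le_B (xi s : R) : `|xi| <= B xi s.
Proof.
have h : 0 <= (`|xi| - 1) ^+ 2 by exact: sqr_ge0.
have s2 : 0 <= s ^+ 2 by exact: sqr_ge0.
rewrite -[xi ^+ 2]real_normK ?num_real//.
have x0 : 0 <= `|xi| by [].
by move: h x0; rewrite sqrrB expr1n mulr1 mulr2n; lra.
Qed.

(** Cauchy-Schwarz in the plane, by Lagrange's identity. *)
Lemma sqr_lin_le xi s k : lin x xi s k ^+ 2 <= vlen k ^+ 2 * (xi ^+ 2 + s ^+ 2).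
Proof.
rewrite sqr_vlen -subr_ge0 (_ : _ - _ = (c * xi - s * x k) ^+ 2) ?sqr_ge0//.
by rewrite /lin; ring.
Qed.

Lemma normr_lin_le xi s k : `|lin x xi s k| <= vlen k * B xi s.
Proof.
have B0 : 0 <= B xi s by apply: le_trans (B_ge1 _ _).
rewrite -(@ler_pXn2r _ 2) ?nnegrE ?mulr_ge0 ?vlen_ge0// real_normK ?num_real//.
apply: le_trans (sqr_lin_le _ _ _) _; rewrite exprMn.
apply: ler_wpM2l; first by rewrite exprn_ge0// vlen_ge0.
by apply: le_trans (_ : B xi s <= _); rewrite ?lerDr// expr2 ler_peMl// B_ge1.
Qed.

Lemma normc_inv_fac_le1 xi s k : normc (fac x xi s k)^-1 <= 1.
Proof.
have h := normc_fac_ge1 x xi s k.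
by rewrite Normc.normcV invf_le1// (lt_le_trans ltr01).
Qed.

(** Expand 1 / (1 + i u) = 1 - i u - u^2 / (1 + i u). The constant terms cancel by sum x_k = 0, the
    linear ones give -xi, and the remainder x_k u_k^2 is cubic in v_k. *)
Lemma log_der0_bound xi s : normc (log_der x 0 xi s - gauss_log_der 0 xi) <=
  vcube * B xi s ^+ 2.
Proof.
have -> : log_der x 0 xi s - gauss_log_der 0 xi =
    \sum_(k < n) 'i%C * ((x k * lin x xi s k ^+ 2)%:C)%C / fac x xi s k.
  have -> : gauss_log_der 0 xi = - \sum_(k < n) ((x k)%:C)%C * ((lin x xi s k)%:C)%C.
    under eq_bigr do rewrite -(rmorphM (real_complex R)).
    by rewrite -(rmorph_sum (real_complex R)) sum_mul_x_lin -(rmorphN (real_complex R)).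
  rewrite opprK /log_der fact0 mul1r/=.
  have sx : \sum_(k < n) 'i%C * ((x k)%:C)%C = 0.
    by rewrite -mulr_sumr -(rmorph_sum (real_complex R)) sum_x mulr0.
  rewrite -[LHS]addr0 -[X in _ + X = _]sx -!big_split; apply: eq_bigr => k _ /=.
  rewrite expr1 !rmorphM/=.
  have := fac_neq0 x xi s k; rewrite /fac => z0.
  have i2 : 'i%C ^+ 2 = -1 :> R[i] by exact: sqr_i.
  move: ((lin x xi s k)%:C)%C ((x k)%:C)%C z0 => u y z0.
  apply: (mulIf z0); rewrite !mulrDl !divfK//.
  rewrite [LHS](_ : _ =
    y * u + 'i%C * y * u ^+ 2 + 'i%C ^+ 2 * (y * u)); last by ring.
  by rewrite i2; ring.
apply: le_trans (normc_sum _ _ _) _; rewrite mulr_suml; apply: ler_sum => k _.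
rewrite !Normc.normcM normc_i mul1r normcR normrM normrX.
apply: (@le_trans _ _ (`|x k| * `|lin x xi s k| ^+ 2)).
  by rewrite ler_piMr ?mulr_ge0 ?exprn_ge0// normc_inv_fac_le1.
rewrite (exprS _ 2) -mulrA -exprMn; apply: ler_pM; rewrite ?exprn_ge0//.
  exact: normr_x_le.
have B0 : 0 <= B xi s by apply: le_trans (B_ge1 _ _).
by rewrite lerXn2r ?nnegrE ?mulr_ge0 ?vlen_ge0// normr_lin_le.
Qed.

(** Writing -1 as - sum x_k^2 leaves the terms x_k^2 (1 - f^-2) with f = 1 + i u_k. The factor 1 -
    f^-1 = i u_k / f supplies the third power of v_k, and |1 + f^-1| <= 2. *)
Lemma log_der1_bound xi s : normc (log_der x 1 xi s - gauss_log_der 1 xi) <=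
  2 * vcube * B xi s.
Proof.
have B0 : 0 <= B xi s by apply: le_trans (B_ge1 _ _).
have -> : log_der x 1 xi s - gauss_log_der 1 xi =
    \sum_(k < n) ((x k ^+ 2)%:C)%C * (1 - (fac x xi s k)^-1) * (1 + (fac x xi s k)^-1).
  rewrite /log_der mul1r/=.
  have -> : (-1 : R[i]) = - \sum_(k < n) ((x k ^+ 2)%:C)%C.
    by rewrite -(rmorph_sum (real_complex R)) sum_x2.
  rewrite opprK -big_split; apply: eq_bigr => k _ /=.
  have i2 : 'i%C ^+ 2 = -1 :> R[i] by exact: sqr_i.
  rewrite rmorphXn/= -mulrA exprMn exprMn sqrrN i2.
  by move: ((x k)%:C)%C (fac x xi s k)^-1 => y w; ring.
apply: le_trans (normc_sum _ _ _) _; rewrite -mulrA mulrCA mulr_suml.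
apply: ler_sum => k _; rewrite !Normc.normcM normcR.
have h1 : normc (1 - (fac x xi s k)^-1) <= vlen k * B xi s.
  apply: le_trans (_ : normc ('i%C * ((lin x xi s k)%:C)%C * (fac x xi s k)^-1) <= _).
    rewrite le_eqVlt; apply/orP; left; apply/eqP; congr normc.
    by have := fac_neq0 x xi s k; rewrite /fac => z0; field.
  rewrite !Normc.normcM normc_i mul1r normcR.
  apply: le_trans (normr_lin_le xi s k).
  by rewrite ler_piMr// normc_inv_fac_le1.
have h2 : normc (1 + (fac x xi s k)^-1) <= 2.
  apply: le_trans (le_normcD _ _) _; rewrite Normc.normc1.
  by rewrite -[2]/(1 + 1) lerD2l normc_inv_fac_le1.
apply: (@le_trans _ _ (vlen k ^+ 2 * (vlen k * B xi s) * 2)); last first.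
  by rewrite le_eqVlt; apply/orP; left; apply/eqP; ring.
apply: ler_pM; rewrite ?mulr_ge0 ?normc_ge0//.
apply: ler_pM; rewrite ?normc_ge0//.
by rewrite normrX lerXn2r ?nnegrE ?vlen_ge0// normr_x_le.
Qed.

Lemma normc_tau_le xi s k : normc (- 'i%C * ((x k)%:C)%C / fac x xi s k) <= `|x k|.
Proof.
rewrite !Normc.normcM normcN normc_i mul1r normcR.
by rewrite ler_piMr// normc_inv_fac_le1.
Qed.

(** The Gaussian has no further logarithmic derivatives, and x_k occurs here to a power of at least
    three. *)
Lemma log_der2_bound b xi s : (forall k, vlen k <= 1) ->
  normc (log_der x b.+2 xi s - gauss_log_der b.+2 xi) <= b.+2`!%:R * vcube.
Proof.
move=> v1; rewrite subr0 Normc.normcM normc_nat ler_wpM2l//.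
apply: le_trans (normc_sum _ _ _) _; apply: ler_sum => k _; rewrite normcX.
apply: (@le_trans _ _ (vlen k ^+ b.+3)).
  rewrite lerXn2r ?nnegrE ?normc_ge0 ?vlen_ge0//.
  exact: le_trans (normc_tau_le _ _ _) (normr_x_le _).
by rewrite ler_wiXn2l// vlen_ge0.
Qed.

Lemma log_der_diff Q b xi s : (forall k, vlen k <= 1) -> (b < Q)%N ->
  normc (log_der x b xi s - gauss_log_der b xi) <= 2 * Q`!%:R * vcube * B xi s ^+ 2.
Proof.
move=> v1 bQ.
have B1 := B_ge1 xi s; have V0 := vcube_ge0.
have B0 : 0 <= B xi s by apply: le_trans B1.
have B2 : B xi s <= B xi s ^+ 2 by rewrite expr2 ler_peMl.
have F1 : 1 <= Q`!%:R :> R by rewrite ler1n fact_gt0.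
have Fb : b`!%:R <= Q`!%:R :> R by rewrite ler_nat leq_fact ?(ltnW bQ).
case: b bQ Fb => [|[|b]] bQ Fb.
- apply: le_trans (log_der0_bound _ _) _.
  rewrite ler_wpM2r ?exprn_ge0//; rewrite ler_peMl//; lra.
- apply: le_trans (log_der1_bound _ _) _.
  apply: ler_pM => //; first by rewrite mulr_ge0.
  by rewrite ler_wpM2r// ler_peMr.
- apply: le_trans (log_der2_bound _ _ _ v1) _.
  rewrite -[leLHS]mulr1; apply: ler_pM; rewrite ?mulr_ge0//; last exact: le_trans B2.
  by rewrite ler_wpM2r//; lra.
Qed.

Lemma gauss_log_der_le b xi s : normc (gauss_log_der b xi) <= B xi s.
Proof.
case: b => [|[|b]].
- by rewrite normcR normrN normr_le_B.
- by rewrite normcN Normc.normc1 B_ge1.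
- by rewrite Normc.normc0 (le_trans _ (B_ge1 _ _)).
Qed.

Lemma decay_ge0 xi s : 0 <= decay xi s.
Proof. by apply: prodr_ge0 => k _; rewrite invr_ge0 normc_ge0. Qed.

Lemma normc_integrand xi s : normc (integrand x xi s) = decay xi s.
Proof.
rewrite Normc.normcM normc_cis mul1r normc_prod; apply: eq_bigr => k _.
by rewrite Normc.normcV.
Qed.

Lemma integrandE xi s :
  integrand x xi s = \prod_(k < n) (cis (lin x xi s k) / fac x xi s k).
Proof.
rewrite /integrand big_split/= -(sum_lin xi s); congr (_ * _).
by apply: (big_morph _ (@cisD R)); exact: cis0.
Qed.

Lemma gauss_prodE xi s :
  ((gauss s)%:C * (gauss xi)%:C)%C = \prod_(k < n) ((gauss (lin x xi s k))%:C)%C.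
Proof.
rewrite -(rmorphM (real_complex R)) -(rmorph_prod (real_complex R)); congr (real_complex R _).
rewrite /gauss -expRD -expR_sum; congr expR.
by rewrite sumrN -mulr_suml sum_sqr_lin; ring.
Qed.

Lemma gauss_le_decay xi s : normc ((gauss s)%:C * (gauss xi)%:C)%C <= decay xi s.
Proof.
rewrite gauss_prodE normc_prod; apply: ler_prod => k _; rewrite normc_ge0 andTb normcR.
rewrite ger0_norm ?(ltW (gauss_gt0 _))// normc_fac.
exact: gauss_le_inv_sqrt.
Qed.

(** Turning the error 3 |u|^3 of one factor into an error relative to its majorant costs |1 + i u|
    <= 2 B, whence the 6 and the fourth power of B. *)
Lemma integrand_diff xi s : (forall k, vlen k <= 1) ->
  normc (integrand x xi s - ((gauss s)%:C * (gauss xi)%:C)%C) <=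
  6 * vcube * B xi s ^+ 4 * decay xi s.
Proof.
move=> v1; rewrite integrandE gauss_prodE.
have B1 := B_ge1 xi s; have B0 : 0 <= B xi s by apply: le_trans B1.
have -> : 6 * vcube * B xi s ^+ 4 = \sum_(k < n) 6 * vlen k ^+ 3 * B xi s ^+ 4.
  by rewrite -!mulr_suml -mulr_sumr.
have f0 k : 0 < normc (fac x xi s k) by apply: lt_le_trans (normc_fac_ge1 _ _ _ _).
apply: normc_prodB => k.
- by rewrite !mulr_ge0 ?exprn_ge0 ?vlen_ge0.
- by rewrite Normc.normcM normc_cis mul1r Normc.normcV.
- rewrite normcR ger0_norm ?(ltW (gauss_gt0 _))// normc_fac.
  exact: gauss_le_inv_sqrt.
- rewrite ler_pdivlMr//.
  have l3 : 3 * `|lin x xi s k| ^+ 3 <= 3 * (vlen k * B xi s) ^+ 3.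
    by rewrite ler_wpM2l// lerXn2r ?nnegrE ?mulr_ge0 ?vlen_ge0// normr_lin_le.
  have f2 : normc (fac x xi s k) <= 2 * B xi s.
    apply: le_trans (le_normcD _ _) _.
    rewrite Normc.normc1 Normc.normcM normc_i mul1r normcR mulr2n mulrDl mul1r lerD//.
    by apply: le_trans (normr_lin_le _ _ _) _; rewrite ler_piMl.
  apply: (@le_trans _ _ (3 * (vlen k * B xi s) ^+ 3 * (2 * B xi s))); last first.
    by rewrite le_eqVlt; apply/orP; left; apply/eqP; ring.
  apply: ler_pM; rewrite ?normc_ge0//.
  exact: le_trans (cis_sub_gauss _) l3.
Qed.

(** [decay] is the square root of the inverse of prod (1 + u_k^2), so [prod_1D_ge] is applied with 2
    K factors to obtain the power K. Its hypothesis u_k^2 <= W / (2 K) is where the v_k must be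
    small. *)
Lemma decay_bound K xi s : (0 < K)%N -> (forall k, vlen k ^+ 2 * (2 * K)%:R <= 1) ->
  decay xi s * B xi s ^+ K <= (2 * K)%:R ^+ K.
Proof.
move=> K0 vK; set L := (2 * K)%N.
have L0 : (0 < L)%N by rewrite muln_gt0.
have LR : 0 < L%:R :> R by rewrite ltr0n.
have L1 : 1 <= L%:R :> R by rewrite ler1n.
set W := xi ^+ 2 + s ^+ 2.
have W0 : 0 <= W by rewrite addr_ge0// sqr_ge0.
have hp : (1 + W / L%:R) ^+ L <= \prod_(k < n) (1 + lin x xi s k ^+ 2).
  apply: prod_1D_ge => // [k|]; last exact: sum_sqr_lin.
  rewrite sqr_ge0/= ler_pdivlMr//; apply: le_trans (_ : vlen k ^+ 2 * W * L%:R <= _).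
    by rewrite ler_wpM2r ?(ltW LR)// sqr_lin_le.
  by rewrite mulrAC ler_piMl.
have d2 : decay xi s ^+ 2 * \prod_(k < n) (1 + lin x xi s k ^+ 2) = 1.
  rewrite /decay -prodrXl -big_split; apply: big1 => k _.
  have p : 0 < 1 + lin x xi s k ^+ 2 by rewrite ltr_pwDl// sqr_ge0.
  by rewrite normc_fac exprVn sqr_sqrtr ?(ltW p)//=; apply: mulVf; rewrite gt_eqF.
have BL : B xi s / L%:R <= 1 + W / L%:R.
  by rewrite mulrDl lerD2r mul1r invf_le1.
have BL0 : 0 <= B xi s / L%:R by rewrite divr_ge0 ?(ltW LR)// (le_trans _ (B_ge1 _ _)).
have h : decay xi s ^+ 2 * (B xi s / L%:R) ^+ L <= 1.
  rewrite -[leRHS]d2 ler_wpM2l ?sqr_ge0//; apply: le_trans hp.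
  by rewrite lerXn2r ?nnegrE// (le_trans BL0).
have h' : decay xi s * (B xi s / L%:R) ^+ K <= 1.
  rewrite -(@ler_pXn2r _ 2) ?nnegrE ?mulr_ge0 ?decay_ge0 ?exprn_ge0//.
  by rewrite exprMn -exprM muln2 -mul2n expr1n.
move: h'; rewrite expr_div_n mulrA ler_pdivrMr ?exprn_gt0// mul1r.
by [].
Qed.

End Estimates.

(** * Weighted bounds on the derivatives of the integrand *)

Section IntegrandEstimates.
Context {R : realType}.
Local Notation normc := (@Normc.normc R).
Local Notation B xi s := (1 + (xi ^+ 2 + s ^+ 2)).

Lemma vlen_le1 (n K : nat) (x : 'I_n -> R) k : (0 < K)%N ->
  vlen x k ^+ 2 * (2 * K)%:R <= 1 -> vlen x k <= 1.
Proof.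
move=> K0 vK; rewrite -(@ler_pXn2r _ 2) ?nnegrE ?vlen_ge0// expr1n.
apply: le_trans vK; rewrite ler_peMr ?sqr_ge0//.
by rewrite ler1n muln_gt0.
Qed.

(** One of the K available powers of B pays for the integrable weight, as 1 + s^2 <= B; the
    remaining ones absorb B^e. *)
Lemma decay_le_invDsqr (n K e : nat) (x : 'I_n -> R) (xi s : R) :
  (0 < n)%N -> \sum_(k < n) x k = 0 -> \sum_(k < n) x k ^+ 2 = 1 ->
  (forall k, vlen x k ^+ 2 * (2 * K)%:R <= 1) -> (e < K)%N ->
  B xi s ^+ e * decay x xi s <= (2 * K)%:R ^+ K * (1 + s ^+ 2)^-1.
Proof.
move=> n0 sx sx2 vK eK.
have K0 : (0 < K)%N by apply: leq_ltn_trans eK.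
have B1 : 1 <= B xi s := B_ge1 xi s.
have B0 : 0 < B xi s by apply: lt_le_trans B1.
have s1 : 0 < 1 + s ^+ 2 by rewrite ltr_pwDl// sqr_ge0.
have := decay_bound n0 sx sx2 xi s K0 vK.
have -> : B xi s ^+ K = B xi s ^+ (K - e.+1) * (B xi s * B xi s ^+ e).
  by rewrite -exprS -exprD subnK.
move=> h.
have d0 := decay_ge0 x xi s.
rewrite ler_pdivlMr//; apply: le_trans h.
rewrite [leRHS](_ : _ = B xi s ^+ e * decay x xi s * (B xi s ^+ (K - e.+1) * B xi s)); last by ring.
apply: ler_wpM2l; first by rewrite mulr_ge0// exprn_ge0// ltW.
apply: (@le_trans _ _ (1 * B xi s)).
  by rewrite mul1r lerD2l lerDr sqr_ge0.
by rewrite ler_wpM2r ?(ltW B0)// exprn_ege1.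
Qed.

Lemma integrand_der_diff (p Q : nat) : exists (K : nat) (C : R),
  [/\ (0 < K)%N, 0 <= C & forall (n : nat) (x : 'I_n -> R), (0 < n)%N ->
   \sum_(k < n) x k = 0 -> \sum_(k < n) x k ^+ 2 = 1 ->
   (forall k, vlen x k ^+ 2 * (2 * K)%:R <= 1) ->
   forall q xi s, (q <= Q)%N ->
   `|xi| ^+ p * normc (integrand_der x q xi s - ((gauss s)%:C)%C * gauss_der q xi) <=
   C * vcube x * (1 + s ^+ 2)^-1].
Proof.
have [C0 C00 H] := @log_tower_diff R Q.
pose F : R := Q`!%:R.
have F1 : 1 <= F by rewrite ler1n fact_gt0.
have F0 : 0 <= F by apply: le_trans F1.
(* The powers of B to be absorbed: p from |xi|^p, 4 from [eps], 2 Q from A^Q. The last one is for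
   integrability in s. *)
pose K := (p + 4 + 2 * Q).+1.
have KR : 0 <= (2 * K)%:R ^+ K :> R by rewrite exprn_ge0.
exists K, (C0 * (6 * F) * (5 * F) ^+ Q * (2 * K)%:R ^+ K); split => //.
  by rewrite !mulr_ge0// exprn_ge0// mulr_ge0.
move=> n x n0 sx sx2 vK q xi s qQ.
have v1 k : vlen x k <= 1 by exact: (@vlen_le1 n K).
have B1 : 1 <= B xi s := B_ge1 xi s.
have B0 : 0 <= B xi s by apply: le_trans B1.
have B2 : B xi s <= B xi s ^+ 2 by rewrite expr2 ler_peMl.
have B24 : B xi s ^+ 2 <= B xi s ^+ 4 by rewrite ler_weXn2l.
have V0 : 0 <= vcube x := vcube_ge0 x.
have V2 : vcube x <= 2 by rewrite -[leRHS]mul1r; exact: vcube_le.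
have D0 : 0 <= decay x xi s := decay_ge0 x xi s.
(* The Gaussian logarithmic derivatives are at most F B^2; the differences are at most 2 F m^3 B^2
   <= 4 F B^2, as m^3 <= 2. [eps] dominates the error of the integrand and those of its logarithmic
   derivatives. *)
pose A := 5 * F * B xi s ^+ 2.
pose eps := 6 * F * vcube x * B xi s ^+ 4.
have TT' b : (b < Q)%N -> normc (log_der x b xi s - gauss_log_der b xi) <= 2 * F * vcube x * B xi s ^+ 2.
  exact: log_der_diff.
have FB : B xi s <= F * B xi s ^+ 2 by apply: le_trans B2 _; rewrite ler_peMl ?exprn_ge0.
have T'A b : normc (gauss_log_der b xi) <= A.
  apply: le_trans (gauss_log_der_le b xi s) _; apply: le_trans FB _.
  by rewrite /A -mulrA ler_peMl ?mulr_ge0 ?exprn_ge0// ler1n.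
have TA b : (b < Q)%N -> normc (log_der x b xi s) <= A.
  move=> bQ; rewrite -[log_der _ _ _ _](subrK (gauss_log_der b xi)).
  apply: le_trans (le_normcD _ _) _.
  apply: le_trans (lerD (TT' b bQ) (gauss_log_der_le b xi s)) _.
  have h : vcube x * (F * B xi s ^+ 2) <= 2 * (F * B xi s ^+ 2).
    by rewrite ler_wpM2r// mulr_ge0// exprn_ge0.
  rewrite /A.
  rewrite (_ : 2 * F * vcube x * B xi s ^+ 2 = 2 * (vcube x * (F * B xi s ^+ 2))); last by ring.
  rewrite -[5 * F * _]mulrA.
  by set a := F * _ in h FB *; set b' := vcube x * a in h *; lra.
have A1 : 1 <= A.
  apply: le_trans B1 _; apply: le_trans FB _.
  by rewrite /A -mulrA ler_peMl ?mulr_ge0 ?exprn_ge0// ler1n.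
have e0 : 0 <= eps by rewrite /eps !mulr_ge0// exprn_ge0.
have nP : normc (integrand x xi s) <= decay x xi s by rewrite normc_integrand.
have pp : normc (integrand x xi s - ((gauss s)%:C * (gauss xi)%:C)%C) <= eps * decay x xi s.
  apply: le_trans (integrand_diff n0 sx sx2 xi s v1) _; rewrite ler_wpM2r// /eps.
  rewrite ler_wpM2r ?exprn_ge0// ler_wpM2r// ler_peMr//.
have te b : (b < Q)%N -> normc (log_der x b xi s - gauss_log_der b xi) <= eps.
  move=> /TT' /le_trans; apply; rewrite /eps; apply: ler_pM; rewrite ?mulr_ge0 ?exprn_ge0//.
  by rewrite ler_wpM2r// ler_wpM2r// ler_nat.
have := H (integrand x xi s) ((gauss s)%:C * (gauss xi)%:C)%C
  (fun b => log_der x b xi s) (fun b => gauss_log_der b xi) A (decay x xi s) eps A1 e0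
  nP (gauss_le_decay n0 sx sx2 xi s) pp TA (fun b _ => T'A b) te q qQ.
rewrite -/(integrand_der x q xi s) (log_towerZ ((gauss s)%:C)%C) -/(gauss_der q xi) => h.
apply: (@le_trans _ _ (B xi s ^+ p * (C0 * eps * A ^+ q * decay x xi s))).
  apply: (ler_pM _ _ _ h); rewrite ?normc_ge0 ?exprn_ge0//.
  by rewrite lerXn2r ?nnegrE// normr_le_B.
have -> : B xi s ^+ p * (C0 * eps * A ^+ q * decay x xi s) =
    C0 * (6 * F) * (5 * F) ^+ q * vcube x * (B xi s ^+ (p + 4 + 2 * q) * decay x xi s).
  by rewrite /eps /A exprMn -exprM !exprD; ring.
have dd : B xi s ^+ (p + 4 + 2 * q) * decay x xi s <= (2 * K)%:R ^+ K * (1 + s ^+ 2)^-1.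
  by apply: decay_le_invDsqr => //; rewrite ltnS leq_add2l leq_mul2l.
have s1 : 0 <= (1 + s ^+ 2)^-1 by rewrite invr_ge0 addr_ge0// sqr_ge0.
rewrite [leRHS](_ : _ = C0 * (6 * F) * (5 * F) ^+ Q * vcube x * ((2 * K)%:R ^+ K * (1 + s ^+ 2)^-1)); last by ring.
have F5 : 1 <= 5 * F by lra.
apply: ler_pM; rewrite ?mulr_ge0 ?exprn_ge0 ?mulr_ge0//.
rewrite ler_wpM2r// ler_wpM2l ?mulr_ge0// ler_weXn2l//.
Qed.

(** Domination at fixed n: as C may depend on n, the crude bound q! n on the logarithmic derivatives
    and decay of order K = 1 are enough. *)
Lemma integrand_der_dominated (n q : nat) (x : 'I_n -> R) : (0 < n)%N ->
  \sum_(k < n) x k = 0 -> \sum_(k < n) x k ^+ 2 = 1 ->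
  (forall k, vlen x k ^+ 2 * 2 <= 1) ->
  exists C : R, forall xi s, normc (integrand_der x q xi s) <= C * (1 + s ^+ 2)^-1.
Proof.
move=> n0 sx sx2 vK; have [C0 C00 H] := @log_tower_bound R q.
have v2 k : vlen x k ^+ 2 * (2 * 1)%:R <= 1 by rewrite muln1.
have v1 k : vlen x k <= 1 by exact: (@vlen_le1 n 1).
pose A : R := q`!%:R * n%:R.
exists (C0 * A ^+ q * 2) => xi s.
have A1 : 1 <= A by rewrite /A -natrM ler1n muln_gt0 fact_gt0.
have TA b : (b < q)%N -> normc (log_der x b xi s) <= A.
  move=> bq; rewrite Normc.normcM normc_nat; apply: ler_pM; rewrite ?normc_ge0//.
    by rewrite ler_nat leq_fact// ltnW.
  apply: le_trans (normc_sum _ _ _) _.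
  have -> : n%:R = \sum_(k < n) (1 : R) by rewrite sumr_const card_ord.
  apply: ler_sum => k _; rewrite normcX exprn_ile1 ?normc_ge0//.
  by apply: le_trans (normc_tau_le _ _ _ _) _; apply: le_trans (normr_x_le _ _) _.
have nP : normc (integrand x xi s) <= decay x xi s by rewrite normc_integrand.
apply: le_trans (H _ (fun b => log_der x b xi s) A _ A1 nP TA q (leqnn q)) _.
have := @decay_le_invDsqr n 1 0 x xi s n0 sx sx2 v2 isT.
rewrite expr0 mul1r muln1 expr1 => d.
rewrite -[leRHS]mulrA; apply: ler_wpM2l => //.
by rewrite mulr_ge0// exprn_ge0// (le_trans _ A1).
Qed.

(** exp(xi^2 / 2) is the K-th power of exp(xi^2 / (2 K)) >= 1 + xi^2 / (2 K), which beats the powers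
    p and q of 1 + xi^2. *)
Lemma gauss_der_bound (p q : nat) :
  exists C : R, forall xi, `|xi| ^+ p * normc (gauss_der q xi) <= C.
Proof.
have [C0 C00 H] := @log_tower_bound R q.
pose K := (p + q).+1.
exists (C0 * (2 * K)%:R ^+ K) => xi.
have b0 : 1 + (xi ^+ 2 + 0 ^+ 2) = 1 + xi ^+ 2 :> R by rewrite expr0n addr0.
have B1 : 1 <= 1 + xi ^+ 2 by rewrite lerDl sqr_ge0.
have B0 : 0 < 1 + xi ^+ 2 by apply: lt_le_trans B1.
have KR : 0 < (2 * K)%:R :> R by rewrite ltr0n.
have hb b : (b < q)%N -> normc (gauss_log_der b xi) <= 1 + xi ^+ 2.
  by move=> _; rewrite -b0; exact: gauss_log_der_le.
have g1 : gauss xi * (1 + xi ^+ 2) ^+ K <= (2 * K)%:R ^+ K.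
  rewrite -ler_pdivlMr ?exprn_gt0// /gauss expRN -[leRHS]invf_div lef_pV2 ?posrE ?expR_gt0 ?divr_gt0 ?exprn_gt0//.
  have -> : xi ^+ 2 / 2 = K%:R * (xi ^+ 2 / (2 * K)%:R).
    by rewrite natrM; field; rewrite pnatr_eq0.
  rewrite expRM_natl -expr_div_n lerXn2r ?nnegrE ?expR_ge0 ?divr_ge0 ?(ltW B0)//.
  apply: le_trans (expR_ge1Dx _); rewrite mulrDl lerD2r mul1r invf_le1//.
  by rewrite ler1n muln_gt0.
have := H ((gauss xi)%:C)%C (fun b => gauss_log_der b xi) (1 + xi ^+ 2) (gauss xi) B1.
rewrite normcR ger0_norm ?(ltW (gauss_gt0 _))// => /(_ (lexx _) hb q (leqnn q)) h.
have xB : `|xi| ^+ p <= (1 + xi ^+ 2) ^+ p.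
  by rewrite lerXn2r ?nnegrE ?(ltW B0)//; have := normr_le_B xi 0; rewrite b0.
apply: le_trans (ler_pM _ _ xB h) _; rewrite ?exprn_ge0 ?normc_ge0//.
rewrite [leLHS](_ : _ = C0 * (gauss xi * (1 + xi ^+ 2) ^+ (p + q))); last by rewrite exprD; ring.
rewrite ler_wpM2l//; apply: le_trans g1.
by rewrite ler_wpM2l ?(ltW (gauss_gt0 _))// ler_weXn2l.
Qed.

End IntegrandEstimates.

(** * The integral of a difference of two simple poles *)

Section PoleIntegral.
Context {R : realType} (tau c : R).
Local Notation normc := (@Normc.normc R).
Hypotheses (tau_gt0 : 0 < tau) (c_gt0 : 0 < c) (c_le1 : c <= 1).

Definition pole (a s : R) : R[i] := cis (tau * c * s) / (1 + 'i%C * ((a + c * s)%:C)%C).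

Let den (a s : R) : R[i] := 1 + 'i%C * ((a + c * s)%:C)%C.

Let normc_den a s : normc (den a s) = Num.sqrt (1 + (a + c * s) ^+ 2).
Proof.
have -> : den a s = (1 +i* (a + c * s))%C.
  by apply/eqP; rewrite eq_complex/=; apply/andP; split; apply/eqP; ring.
by rewrite /= expr1n.
Qed.

Let den_neq0 a s : den a s != 0.
Proof.
apply/eqP => d0; have := normc_den a s; rewrite d0 Normc.normc0 => /esym/eqP.
by rewrite sqrtr_eq0 leNgt ltr_pwDl// sqr_ge0.
Qed.

(** One pole decays only like 1 / |s|; the difference carries the product of both denominators and
    decays like 1 / s^2. *)
Lemma cintegrable_poleB (a b : R) : cintegrable (fun s => pole a s - pole b s).
Proof.
have c2 : 0 < c ^+ 2 by rewrite exprn_gt0.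
have bound (d s : R) : (normc (den d s)) ^- 2 <= (2 + 2 * d ^+ 2) / c ^+ 2 * (1 + s ^+ 2)^-1.
  have s0 : 0 < 1 + s ^+ 2 by rewrite ltr_pwDl// sqr_ge0.
  have e0 : 0 < 1 + (d + c * s) ^+ 2 by rewrite ltr_pwDl// sqr_ge0.
  rewrite normc_den sqr_sqrtr ?(ltW e0)// -mulrA -invfM -[leLHS]mul1r.
  rewrite ler_pdivrMr// mulrAC ler_pdivlMr ?mulr_gt0// mul1r.
  have h1 : c ^+ 2 <= 1 by rewrite expr_le1// ltW.
  have h2 : 0 <= (2 * d + c * s) ^+ 2 by exact: sqr_ge0.
  have h3 : 0 <= d ^+ 2 * (d + c * s) ^+ 2 by rewrite mulr_ge0 ?sqr_ge0.
  (* With e = d + c s one has c s = e - d, and 2 d^2 + 2 e^2 - (e - d)^2 = (d + e)^2. *)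
  rewrite -subr_ge0 (_ : _ - _ = (1 - c ^+ 2) + 1 + (2 * d + c * s) ^+ 2 + 2 * (d ^+ 2 * (d + c * s) ^+ 2)); last by ring.
  by apply: addr_ge0; [apply: addr_ge0 => //; apply: addr_ge0; rewrite ?subr_ge0|exact: mulr_ge0].
pose C (d : R) := (2 + 2 * d ^+ 2) / c ^+ 2.
apply: (@le_cintegrable _ _ (fun s => `|b - a| * ((C a + C b) / 2) * (1 + s ^+ 2)^-1)).
- move=> s; have dden d : is_cderive (fun t => den d t) s ('i%C * (c%:C)%C).
    rewrite -[X in is_cderive _ _ X]add0r; apply: is_cderiveD; first exact: is_cderive_cst.
    apply: is_cderiveZ; apply: is_cderive_real.
    exact: is_derive_affine.
  have dl : is_derive s 1 (fun t => tau * c * t) (tau * c).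
    have -> : (fun t => tau * c * t) = (fun t => 0 + tau * c * t).
      by apply/funext => t; rewrite add0r.
    exact: is_derive_affine.
  have dp d := is_cderiveM (is_cderive_cis dl) (is_cderiveV (den_neq0 d s) (dden d)).
  have := is_cderiveD (dp a) (is_cderiveZ (-1) (dp b)).
  under eq_fun do rewrite mulN1r.
  by move=> h; eexists; exact: h.
- move=> s; have -> : pole a s - pole b s =
      cis (tau * c * s) * ('i%C * ((b - a)%:C)%C) / (den a s * den b s).
    have a0 := den_neq0 a s; have b0 := den_neq0 b s.
    rewrite /pole -/(den a s) -/(den b s) -mulrBr -[RHS]mulrA; congr (_ * _).
    have -> : 'i%C * ((b - a)%:C)%C = den b s - den a s.
      rewrite /den !rmorphD rmorphN/=; ring.
    by field; rewrite a0 b0.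
  rewrite Normc.normcM Normc.normcV !Normc.normcM normc_cis normc_i !mul1r normcR -mulrA.
  apply: ler_wpM2l => //; rewrite invfM.
  apply: (@le_trans _ _ (((normc (den a s)) ^- 2 + (normc (den b s)) ^- 2) / 2)).
    rewrite -!exprVn ler_pdivlMr// mulrC mulr_natl -subr_ge0.
    rewrite [X in 0 <= X](_ : _ = ((normc (den a s))^-1 - (normc (den b s))^-1) ^+ 2) ?sqr_ge0//.
    by rewrite sqrrB; ring.
  rewrite mulrAC ler_wpM2r// mulrDl; apply: lerD; exact: bound.
- rewrite /comp; under eq_fun do rewrite EFinM.
  by apply: integrableZl => //; exact: integrable_invDsqr.
Qed.

(* Translation by b / c turns [pole a] into a multiple of [pole (a + b)], so the
   integrals satisfy a cocycle identity that determines them up to a factor. *)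
Lemma pole_integral : exists nu : R[i], forall a : R,
  cintegral (fun s => pole a s - pole 0 s) = nu * (1 - cis (- (tau * a))).
Proof.
pose J (a : R) := cintegral (fun s => pole a s - pole 0 s).
have c0 : c != 0 by rewrite gt_eqF.
have shift (a b s : R) : pole a (s + b / c) = cis (tau * b) * pole (a + b) s.
  rewrite /pole mulrA -cisD; congr (cis _ / (1 + 'i%C * ((_)%:C)%C)); first by field.
  by field.
have cocycle a b : J (a + b) = J b + cis (- (tau * b)) * J a.
  have -> : J a = cis (tau * b) * cintegral (fun s => pole (a + b) s - pole b s).
    rewrite /J -(@cintegral_shift _ _ (b / c)); last exact: cintegrable_poleB.
    rewrite -cintegralZ; last exact: cintegrable_poleB.
    by congr cintegral; apply/funext => s; rewrite !shift add0r mulrBr.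
  rewrite mulrA -cisD addNr cis0 mul1r -cintegralD; try exact: cintegrable_poleB.
  by congr cintegral; apply/funext => s; ring.
(* Exchanging a and b in the cocycle identity gives J(a) (1 - cis(- tau b)) = J(b) (1 - cis(- tau
   a)); this b makes the first bracket equal to 2. *)
pose b := pi / tau.
have cb : cis (- (tau * b)) = -1 :> R[i].
  rewrite /b mulrCA mulfV ?gt_eqF// mulr1 /cis cosN cospi sinN sinpi oppr0.
  by apply/eqP; rewrite eq_complex/= oppr0 !eqxx.
exists (J b / 2) => a; rewrite -/(J a).
have := cocycle b a; rewrite addrC (cocycle a b) cb => e.
have two0 : (2 : R[i]) != 0 by rewrite pnatr_eq0.
apply: (mulIf two0); rewrite mulrAC divfK//.
have -> : J a * 2 = J a - (J b + -1 * J a) + J b by ring.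
by rewrite e; ring.
Qed.

End PoleIntegral.

(** * The exponential sum as an integral *)

Section Representation.
Context {R : realType} (n : nat) (x : 'I_n -> R).
Local Notation normc := (@Normc.normc R).
Local Notation c := (Num.sqrt (n%:R : R))^-1.

Hypothesis n_gt1 : (1 < n)%N.
Hypothesis x_inj : injective x.
Hypothesis sum_x : \sum_(k < n) x k = 0.
Hypothesis sum_x2 : \sum_(k < n) x k ^+ 2 = 1.
Hypothesis vlen_small : forall k, vlen x k ^+ 2 * 2 <= 1.

Let n_gt0 : (0 < n)%N. Proof. exact: ltnW. Qed.

Definition integral_der (q : nat) (xi : R) : R[i] :=
  cintegral (integrand_der x q xi).

Definition node_weight (k : 'I_n) : R[i] :=
  (\prod_(j < n | j != k) ((x k - x j)%:C)%C)^-1.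

(** For q = 0, the divided difference of y -> exp(- i n xi y) at the nodes x_k; for larger q, its
    derivatives in xi. *)
Definition expsum_der (q : nat) (xi : R) : R[i] :=
  \sum_(k < n) node_weight k * ((- 'i%C * ((n%:R * x k)%:C)%C) ^+ q * cis (- (n%:R * xi * x k))).

Lemma cintegrable_integrand_der q xi : cintegrable (integrand_der x q xi).
Proof.
have [C HC] := integrand_der_dominated q n_gt0 sum_x sum_x2 vlen_small.
apply: (@le_cintegrable _ _ (fun s => C * (1 + s ^+ 2)^-1)) => //.
- by move=> s; exact: cderivable_integrand_der2.
- rewrite /comp; under eq_fun do rewrite EFinM.
  by apply: integrableZl => //; exact: integrable_invDsqr.
Qed.

Lemma is_cderive_integral_der q xi :
  is_cderive (integral_der q) xi (integral_der q.+1 xi).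
Proof.
have [C HC] := integrand_der_dominated q.+1 n_gt0 sum_x sum_x2 vlen_small.
apply: (@is_cderive_cintegral _ (integrand_der x q) (integrand_der x q.+1)
  (fun s => C * (1 + s ^+ 2)^-1)) => //.
- exact: cintegrable_integrand_der.
- by move=> y s; exact: is_cderive_integrand_der1.
- rewrite /comp; under eq_fun do rewrite EFinM.
  by apply: integrableZl => //; exact: integrable_invDsqr.
Qed.

Lemma is_cderive_expsum_der q xi : is_cderive (expsum_der q) xi (expsum_der q.+1 xi).
Proof.
apply: is_cderive_sum => k; apply: is_cderiveZ.
rewrite exprSr -mulrA; apply: is_cderiveZ.
have h : is_derive xi 1 (fun t => - (n%:R * t * x k)) (- (n%:R * x k)).
  have -> : (fun t => - (n%:R * t * x k)) = - (cst n%:R * id * cst (x k)) :> (R -> R) by [].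
  by apply: is_derive_eq; rewrite /GRing.scale/=; ring.
have := is_cderive_cis h; congr is_cderive.
by rewrite rmorphN/=; ring.
Qed.

Lemma complex_inj : injective (fun k => ((x k)%:C)%C : R[i]).
Proof. by move=> i j /complexI /x_inj. Qed.

Lemma sum_node_weight (p : {poly R[i]}) : (size p <= n)%N ->
  \sum_(k < n) p.[((x k)%:C)%C] * node_weight k = p`_n.-1.
Proof.
move=> sp; rewrite -(sum_div_prod_sub complex_inj sp); apply: eq_bigr => k _.
by congr (_ / _); apply: eq_bigr => j _; rewrite rmorphB.
Qed.

Lemma integral_representation : exists mu : R[i], forall xi : R, xi != 0 ->
  ((xi%:C)%C ^+ n.-1) * integral_der 0 xi = mu * expsum_der 0 xi.
Proof.
have nR : 1 <= n%:R :> R by rewrite ler1n.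
have c0 : 0 < c by rewrite invr_gt0 sqrtr_gt0 (lt_le_trans _ nR).
have c1 : c <= 1.
  by rewrite invf_le1 ?sqrtr_gt0 ?(lt_le_trans _ nR)// -[leLHS]sqrtr1 ler_wsqrtr.
have nR0 : 0 < n%:R :> R by rewrite (lt_le_trans _ nR).
have [nu Hnu] := @pole_integral R n%:R c nR0 c0 c1.
exists (- nu * (- 'i%C) ^- n.-1) => xi xi0.
have i0 : 'i%C != 0 :> R[i] by rewrite eq_complex/= oner_eq0 andbF.
have xiC0 : ((xi%:C)%C : R[i]) != 0 by rewrite eq_complex/= eqxx andbT.
have nodeE k : \prod_(j < n | j != k) (fac x xi 0 j - fac x xi 0 k) =
    (- 'i%C * (xi%:C)%C) ^+ n.-1 * (node_weight k)^-1.
  rewrite invrK.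
  have -> : (- 'i%C * (xi%:C)%C) ^+ n.-1 = \prod_(j < n | j != k) (- 'i%C * (xi%:C)%C).
    by rewrite prodr_const cardC1 card_ord.
  rewrite -big_split; apply: eq_bigr => j _ /=.
  by rewrite /fac /lin !rmorphD !rmorphN !rmorphM/=; ring.
have facB s j k : fac x xi s j - fac x xi s k = fac x xi 0 j - fac x xi 0 k.
  by rewrite /fac /lin !rmorphD/=; ring.
have fac_inj s : injective (fac x xi s).
  move=> j k /eqP; rewrite -subr_eq0 facB /fac /lin => /eqP e.
  apply: x_inj; apply: (mulfI xi0); apply: complexI; apply: (mulfI i0).
  apply/eqP; rewrite -subr_eq0 -mulrBr; apply/eqP; rewrite -{}e !rmorphD/=; ring.
(* The partial fraction weights are free of s, because the factors differ by i xi (x_j - x_k). *)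
pose a k : R[i] := ((- 'i%C * (xi%:C)%C) ^+ n.-1)^-1 * node_weight k.
have aE s k : (\prod_(j < n | j != k) (fac x xi s j - fac x xi s k))^-1 = a k.
  by under eq_bigr do rewrite facB; rewrite nodeE invfM invrK.
(* Used twice: to subtract the pole at 0 from each term, which makes the terms integrable, and to
   drop the constant 1 from their integrals. *)
have sum_a : \sum_(k < n) a k = 0.
  rewrite -mulr_sumr; have := @sum_node_weight 1%:P.
  rewrite size_polyC oner_eq0 coefC => /(_ n_gt0).
  rewrite (_ : (n.-1 == 0)%N = false); last by move: n_gt1; case: (n) => [|[|]].
  by under eq_bigr do rewrite hornerC mul1r; move=> ->; rewrite mulr0.
have integrandE' s : integrand_der x 0 xi s =
    \sum_(k < n) a k * (pole n%:R c (xi * x k) s - pole n%:R c 0 s).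
  under eq_bigr do rewrite mulrBr.
  rewrite sumrB -[X in _ - X]mulr_suml sum_a mul0r subr0.
  rewrite [LHS]/integrand_der/= [LHS]/log_tower/= /integrand prodfV.
  rewrite (partial_fractions (fac_inj s) n_gt0 (fac_neq0 x xi s)) mulr_sumr.
  by apply: eq_bigr => k _; rewrite aE /pole mulrCA.
rewrite /integral_der (_ : integrand_der x 0 xi =
  fun s => \sum_(k < n) a k * (pole n%:R c (xi * x k) s - pole n%:R c 0 s)); last exact/funext.
rewrite cintegral_sum; last first.
  by move=> k; apply: cintegrableZ; exact: cintegrable_poleB.
rewrite (eq_bigr (fun k => nu * a k - nu * (a k * cis (- (n%:R * xi * x k))))) => [|k _]; last first.
  rewrite cintegralZ; last exact: cintegrable_poleB.
  by rewrite Hnu -(mulrA n%:R xi); ring.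
rewrite sumrB -[X in X - _]mulr_sumr sum_a mulr0 sub0r -sumrN !mulr_sumr.
apply: eq_bigr => k _; rewrite /a expr0 mul1r exprMn.
have iN0 : (- 'i%C) ^+ n.-1 != 0 :> R[i] by rewrite expf_neq0// oppr_eq0.
have xiN0 : (xi%:C)%C ^+ n.-1 != 0 :> R[i] by rewrite expf_neq0.
move: ((- 'i%C) ^+ n.-1) ((xi%:C)%C ^+ n.-1) iN0 xiN0 => u v u0 v0.
by field; rewrite u0 v0.
Qed.

(** Differentiate the identity n - 1 times at 0. On the left only the term with all derivatives on
    xi^(n-1) survives; on the right the weighted sum of the x_k^(n-1) is 1. *)
Lemma integral_normalization (mu : R[i]) :
  (forall xi : R, xi != 0 -> ((xi%:C)%C ^+ n.-1) * integral_der 0 xi = mu * expsum_der 0 xi) ->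
  n.-1`!%:R * integral_der 0 0 = mu * (- 'i%C * n%:R) ^+ n.-1.
Proof.
move=> rep.
(* The derivatives of t^(n-1). Past order n - 1 the exponent truncates to 0, but the falling
   factorial vanishes. *)
pose X (b : nat) (t : R) : R[i] := (n.-1 ^_ b)%:R * (t%:C)%C ^+ (n.-1 - b).
have dX b t : is_cderive (X b) t (X b.+1 t).
  have := is_cderiveZ (n.-1 ^_ b)%:R
    (is_cderiveX (n.-1 - b) (is_cderive_real (is_derive_id t 1))).
  congr is_cderive; rewrite /X ffactnSr natrM subnS mulr1; ring.
have n1 : (0 < n.-1)%N by move: n_gt1; case: (n) => [|[|]].
have rep0 t : X 0 t * integral_der 0 t = mu * expsum_der 0 t.
  rewrite /X ffactn0 mul1r subn0; have [->|t0] := eqVneq t 0; last exact: rep.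
  rewrite expr0n gtn_eqF// mul0r /expsum_der.
  have := @sum_node_weight 1%:P; rewrite size_polyC oner_eq0 coefC gtn_eqF//.
  move=> /(_ n_gt0); under eq_bigr do rewrite hornerC mul1r; move=> sw.
  under eq_bigr do rewrite expr0 mul1r mulr0 mul0r oppr0 cis0 mulr1.
  by rewrite sw mulr0.
pose L (q : nat) (t : R) : R[i] := \sum_(b < q.+1) 'C(q, b)%:R * (X b t * integral_der (q - b) t).
pose S (q : nat) (t : R) : R[i] := mu * expsum_der q t.
have := @tower_eq _ setT L S n.-1 0 openT.
have -> : L n.-1 0 = n.-1`!%:R * integral_der 0 0.
  rewrite /L big_ord_recr/= big1 => [|b _].
    by rewrite add0r binn mul1r subnn /X ffactnn subnn expr0 mulr1.
  by rewrite /X expr0n subn_eq0 leqNgt ltn_ord/= mulr0 mul0r mulr0.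
have -> : S n.-1 0 = mu * (- 'i%C * n%:R) ^+ n.-1.
  rewrite /S /expsum_der; congr (_ * _).
  have := @sum_node_weight ('X^(n.-1)); rewrite size_polyXn prednK// leqnn coefXn eqxx => /(_ isT) sw.
  transitivity ((- 'i%C * n%:R) ^+ n.-1 * \sum_(k < n) ('X^(n.-1)).[((x k)%:C)%C] * node_weight k); last first.
    by rewrite sw mulr1.
  rewrite mulr_sumr; apply: eq_bigr => k _.
  rewrite mulr0 mul0r oppr0 cis0 mulr1 hornerXn rmorphM/= rmorph_nat mulrA exprMn.
  by rewrite [RHS]mulrA [LHS]mulrC.
apply.
- move=> b t _; apply: is_cderive_leibniz => b' _; first exact: dX.
  exact: is_cderive_integral_der.
- by move=> b t _; apply: is_cderiveZ; exact: is_cderive_expsum_der.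
- by move=> t _; rewrite /L big_ord1 bin0 mul1r subnn rep0.
- by [].
Qed.

End Representation.

(** * Hermite sums *)

Section HermiteTower.
Context {R : realType} (n : nat) (x : 'I_n -> R).
Hypothesis n_gt0 : (0 < n)%N.

(** The b-th derivative of xi^(1-n). *)
Definition negpow_der (b : nat) (xi : R) : R[i] :=
  \prod_(l < b) (1 - n%:R - l%:R) * ((xi%:C)%C ^+ (n.-1 + b))^-1.

Lemma is_cderive_negpow_der b xi : xi != 0 ->
  is_cderive (negpow_der b) xi (negpow_der b.+1 xi).
Proof.
move=> xi0.
have xiC0 : (xi%:C)%C != 0 :> R[i] by rewrite eq_complex/= eqxx andbT.
have := is_cderiveZ (\prod_(l < b) (1 - n%:R - l%:R))
  (is_cderiveV (expf_neq0 (n.-1 + b) xiC0)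
    (is_cderiveX (n.-1 + b) (is_cderive_real (is_derive_id xi 1)))).
congr is_cderive; rewrite /negpow_der big_ord_recr/= -[RHS]mulrA; congr (_ * _).
have -> : (1 - n%:R - b%:R : R[i]) = - (n.-1 + b)%:R.
  by rewrite natrD -{1}(prednK n_gt0) -natr1; ring.
rewrite addnS; case: (n.-1 + b)%N => [|e]; first by rewrite !mul0r !oppr0 !mul0r.
have e0 := expf_neq0 e xiC0; rewrite /= (exprS _ e.+1) (exprS _ e).
move: ((xi%:C)%C) ((xi%:C)%C ^+ e) xiC0 e0 => z w z0 w0.
by rewrite (rmorph1 (real_complex R)); field; rewrite z0 w0.
Qed.

Lemma CrnE r : (-1) ^+ r * Crn R r n = r`!%:R * Crn R 0 n.
Proof.
rewrite /Crn muln0 add0n fact0 mulr1 -addnBA// exprD exprM sqr_i.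
have s : (-1) ^+ r * (-1) ^+ r = 1 :> R[i] by rewrite -expr2 sqrr_sign.
rewrite [LHS](_ : _ = ((-1) ^+ r * (-1) ^+ r) * (r`!%:R * ((n - 2)`!%:R * 'i%C ^+ (n - 1) / n%:R ^+ (n - 2)))); last by ring.
by rewrite s mul1r.
Qed.

(** Reversing the summation turns the Laguerre coefficients, times r!, into binomial coefficients
    times falling factorials of 1 - n, the shape that Leibniz's rule produces. *)
Lemma laguerre_horner r (z : R[i]) :
  r`!%:R * (map_poly (real_complex R) (laguerre r (- n%:R - r%:R + 1))).[z] =
  \sum_(b < r.+1) 'C(r, b)%:R * (\prod_(l < b) (1 - n%:R - l%:R)) * (- z) ^+ (r - b).
Proof.
rewrite (@horner_coef_wide _ r.+1); last first.
  by rewrite size_map_poly; exact: size_poly.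
rewrite (reindex_inj rev_ord_inj) mulr_sumr; apply: eq_bigr => b _ /=.
have br : (b <= r)%N by rewrite -ltnS.
rewrite subSS coef_map coef_poly ltnS leq_subr subKn//.
rewrite [in RHS]exprNn /gbinom.
have -> : r%:R + (- n%:R - r%:R + 1) = 1 - n%:R :> R by ring.
rewrite /= !(rmorphM, rmorph_prod) /= !fmorphV !rmorph_nat rmorphXn/= rmorphN1.
under eq_bigr do rewrite !rmorphB/= rmorph1 !rmorph_nat.
rewrite -(bin_fact br) !natrM.
have f1 : (b`!%:R : R[i]) != 0 by rewrite pnatr_eq0 -lt0n fact_gt0.
have f2 : ((r - b)`!%:R : R[i]) != 0 by rewrite pnatr_eq0 -lt0n fact_gt0.
by field; rewrite f1 f2.
Qed.

(** The right side is Leibniz's rule for the r-th derivative of xi^(1-n) times the exponential sum;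
    term by term this is Rodrigues' formula. *)
Lemma hermite_sumE r (xi : R) : xi != 0 ->
  (-1) ^+ r * hermite_sum r x xi = Crn R 0 n *
    \sum_(b < r.+1) 'C(r, b)%:R * (negpow_der b xi * expsum_der x (r - b) xi).
Proof.
move=> xi0.
have xiC0 : (xi%:C)%C != 0 :> R[i] by rewrite eq_complex/= eqxx andbT.
rewrite /hermite_sum mulrA (mulrA ((-1) ^+ r)) CrnE -addnBAC// subn1.
rewrite [X in X * _](_ : _ = Crn R 0 n * ((xi%:C)%C ^+ (n.-1 + r))^-1 * r`!%:R); last by rewrite [r`!%:R * _]mulrC mulrAC.
rewrite -!(mulrA (Crn R 0 n)); congr (_ * _); rewrite -mulrA !mulr_sumr.
pose Y (k : 'I_n) (b : 'I_r.+1) : R[i] := 'C(r, b)%:R * (negpow_der b xi *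
  (node_weight x k * ((- 'i%C * ((n%:R * x k)%:C)%C) ^+ (r - b) * cis (- (n%:R * xi * x k))))).
transitivity (\sum_(k < n) \sum_(b < r.+1) Y k b); last first.
  rewrite exchange_big/=; apply: eq_bigr => b _.
  by rewrite /expsum_der !mulr_sumr.
apply: eq_bigr => k _; rewrite (mulrCA r`!%:R) laguerre_horner !mulr_sumr.
apply: eq_bigr => b _.
have br : (b <= r)%N by rewrite -ltnS.
rewrite /Y /negpow_der /node_weight.
have -> : - ('i%C * ((n%:R * xi * x k)%:C)%C) = - 'i%C * ((n%:R * x k)%:C)%C * (xi%:C)%C :> R[i].
  by rewrite !rmorphM/=; ring.
rewrite exprMn.
have -> : (xi%:C)%C ^+ (n.-1 + r) = (xi%:C)%C ^+ (n.-1 + b) * (xi%:C)%C ^+ (r - b) :> R[i].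
  by rewrite -exprD -addnA subnKC.
have u0 := expf_neq0 (n.-1 + b) xiC0; have v0 := expf_neq0 (r - b) xiC0.
rewrite invfM; move: (\prod_(j < n | j != k) _)^-1 => w.
move: ((xi%:C)%C ^+ (n.-1 + b)) ((xi%:C)%C ^+ (r - b)) u0 v0 => u v u0 v0.
by field; rewrite u0 v0.
Qed.

End HermiteTower.

(** * The Gaussian integral, of which only positivity is established *)

Section GaussIntegral.
Context {R : realType}.
Local Notation mu := (@lebesgue_measure R).

Definition gauss_mass : R := \int[mu]_s gauss s.

Lemma gauss_le_invDsqr (s : R) : gauss s <= 2 * (1 + s ^+ 2)^-1.
Proof.
have s2 : 0 <= s ^+ 2 by exact: sqr_ge0.
rewrite ler_pdivlMr ?ltr_pwDl// /gauss expRN mulrC ler_pdivrMr ?expR_gt0//.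
have := expR_ge1Dx (s ^+ 2 / 2); lra.
Qed.

Lemma continuous_gauss : continuous (@gauss R).
Proof.
have cs (s : R) : exists d : R, is_derive s 1 (@gauss R) d.
  have [h _] := is_cderive_gauss_der 0 s.
  by exists (complex.Re (gauss_der 1 s)).
move=> s; apply: differentiable_continuous; apply/derivable1_diffP.
by have [d []] := cs s.
Qed.

Lemma integrable_gauss : mu.-integrable setT (EFin \o @gauss R).
Proof.
apply: (@le_integrable_continuous _ _ (fun s => 2 * (1 + s ^+ 2)^-1)).
- exact: continuous_gauss.
- by move=> s; rewrite ger0_norm ?(ltW (gauss_gt0 _))// gauss_le_invDsqr.
- rewrite /comp; under eq_fun do rewrite EFinM.
  by apply: integrableZl => //; exact: integrable_invDsqr.
Qed.

Lemma gauss_mass_gt0 : 0 < gauss_mass.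
Proof.
have e0 : 0 < expR (- (1 / 2)) :> R by exact: expR_gt0.
have mg : measurable_fun setT (@gauss R) by exact: continuous_measurable_fun continuous_gauss.
apply: (lt_le_trans e0); rewrite -lee_fin /gauss_mass /Rintegral fineK; last first.
  exact: integrable_fin_num integrable_gauss.
apply: (@le_trans _ _ (\int[mu]_(s in `[0%R, 1%R]) (gauss s)%:E)%E); last first.
  apply: ge0_subset_integral => //; first exact/measurable_EFinP.
  by move=> s _; rewrite lee_fin ltW// gauss_gt0.
apply: (@le_trans _ _ (\int[mu]_(s in `[0%R, 1%R]) (expR (- (1 / 2)))%:E)%E).
  by rewrite integral_cst//= lebesgue_measure_itv/= lte_fin ltr01 oppr0 adde0 mule1.
apply: ge0_le_integral => //.
- by apply/measurable_EFinP; exact: measurable_funTS.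
- move=> s; rewrite /= in_itv/= => /andP[s0 s1]; rewrite lee_fin /gauss ler_expR lerN2.
  by rewrite ler_pM2r// -[leRHS](expr1n _ 2) lerXn2r ?nnegrE.
Qed.

Lemma cintegrable_gaussM (a : R[i]) : cintegrable (fun s => ((gauss s)%:C)%C * a).
Proof.
under eq_fun do rewrite mulrC; apply: cintegrableZ; split => //=.
  exact: integrable_gauss.
exact: integrable0.
Qed.

Lemma cintegral_gaussM (a : R[i]) :
  cintegral (fun s => ((gauss s)%:C)%C * a) = (gauss_mass%:C)%C * a.
Proof.
have gi : cintegrable (fun s : R => ((gauss s)%:C)%C).
  by split; [exact: integrable_gauss|exact: integrable0].
rewrite [RHS]mulrC [in RHS](_ : (gauss_mass%:C)%C = cintegral (fun s : R => ((gauss s)%:C)%C)).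
  by rewrite -cintegralZ//; congr cintegral; apply/funext => s; rewrite mulrC.
by rewrite /cintegral/= /Rintegral integral0.
Qed.

End GaussIntegral.

(** * Comparison of the integrals, smallness of the v_k, and the normalising constant *)

Section Normalization.
Context {R : realType}.
Local Notation normc := (@Normc.normc R).
Local Notation mu := (@lebesgue_measure R).

Lemma vlen_sqr2_le1 (n K : nat) (x : 'I_n -> R) k : (0 < K)%N ->
  vlen x k ^+ 2 * (2 * K)%:R <= 1 -> vlen x k ^+ 2 * 2 <= 1.
Proof.
move=> K0; apply: le_trans; rewrite ler_wpM2l ?sqr_ge0//.
by rewrite ler_nat leq_pmulr.
Qed.

Lemma integral_der_diff (p Q : nat) : exists (K : nat) (C : R),
  [/\ (0 < K)%N, 0 <= C & forall (n : nat) (x : 'I_n -> R), (1 < n)%N ->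
   \sum_(k < n) x k = 0 -> \sum_(k < n) x k ^+ 2 = 1 ->
   (forall k, vlen x k ^+ 2 * (2 * K)%:R <= 1) ->
   forall q xi, (q <= Q)%N ->
   `|xi| ^+ p * normc (integral_der x q xi - (gauss_mass%:C)%C * gauss_der q xi) <=
   C * vcube x].
Proof.
have [K [C [K0 C0 H]]] := @integrand_der_diff R p Q.
pose M : R := \int[mu]_s (1 + s ^+ 2)^-1.
have M0 : 0 <= M by apply: Rintegral_ge0 => s _; rewrite invr_ge0 addr_ge0// sqr_ge0.
exists K, (2 * (C * M)); split => //; first by rewrite !mulr_ge0.
move=> n x n1 sx sx2 vK q xi qQ.
have v2 k : vlen x k ^+ 2 * 2 <= 1 by exact: (@vlen_sqr2_le1 n K).
have iD : cintegrable (integrand_der x q xi).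
  exact: cintegrable_integrand_der.
have iG := @cintegrable_gaussM R (gauss_der q xi).
rewrite -cintegral_gaussM -cintegralB//.
rewrite -(normr_id xi) -normrX -normcR -Normc.normcM.
rewrite -cintegralZ; last exact: cintegrableB.
have iM : mu.-integrable setT (EFin \o (fun s : R => C * vcube x * (1 + s ^+ 2)^-1)).
  rewrite /comp; under eq_fun do rewrite EFinM.
  by apply: integrableZl => //; exact: integrable_invDsqr.
apply: le_trans (normc_cintegral_le (g := fun s => C * vcube x * (1 + s ^+ 2)^-1) _ _ iM) _.
- by apply: cintegrableZ; exact: cintegrableB.
- move=> s; rewrite Normc.normcM normcR normrX normr_id.
  by apply: H => //; exact: ltnW.
- rewrite RintegralZl//; last exact: integrable_invDsqr.
  by rewrite le_eqVlt; apply/orP; left; apply/eqP; rewrite -/M; ring.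
Qed.

(** Every |v_k| is at least n^(-1/2), so m^3 >= n^(-1/2) >= 1/n. This absorbs the deviation of n /
    (n - 1) from 1. *)
Lemma inv_n_le_vcube (n : nat) (x : 'I_n -> R) : (0 < n)%N -> n%:R^-1 <= vcube x.
Proof.
move=> n0; set c : R := (Num.sqrt n%:R)^-1.
have nR : 1 <= n%:R :> R by rewrite ler1n.
have c0 : 0 <= c by rewrite invr_ge0 sqrtr_ge0.
have c1 : c <= 1.
  by rewrite invf_le1 ?sqrtr_gt0 ?(lt_le_trans _ nR)// -[leLHS]sqrtr1 ler_wsqrtr.
have c2 : c ^+ 2 = n%:R^-1 by exact: sqr_c.
have cv k : c <= vlen x k.
  rewrite -(ger0_norm c0) -sqrtr_sqr; apply: ler_wsqrtr.
  by rewrite lerDr sqr_ge0.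
apply: (@le_trans _ _ (\sum_(k < n) c ^+ 3)); last first.
  by apply: ler_sum => k _; rewrite lerXn2r ?nnegrE ?vlen_ge0.
rewrite sumr_const card_ord -[c ^+ 3 *+ n]mulr_natl (exprSr c 2) c2 mulrA mulfV ?mul1r; last first.
  by rewrite pnatr_eq0 -lt0n.
by rewrite -c2 expr2 ler_piMr.
Qed.

(** A single |x_k|^3 is at most the whole sum, so x_k^2 and 1/n are both at most 1 / (4 T^2). *)
Lemma vlen_le_of_cubes (n T : nat) (x : 'I_n -> R) k : (0 < T)%N ->
  (4 * T ^ 2 <= n)%N -> \sum_(k < n) `|x k| ^+ 3 <= ((2 * T)%:R^-1) ^+ 3 ->
  vlen x k <= T%:R^-1.
Proof.
move=> T0 Tn sx3.
have TR : 0 < T%:R :> R by rewrite ltr0n.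
have n0 : (0 < n)%N by apply: leq_trans Tn; rewrite muln_gt0 expn_gt0 T0.
have xk : `|x k| <= (2 * T)%:R^-1.
  rewrite -(@ler_pXn2r _ 3) ?nnegrE ?invr_ge0//; apply: le_trans sx3.
  by rewrite (bigD1 k)//= lerDl sumr_ge0// => j _; rewrite exprn_ge0.
rewrite -(@ler_pXn2r _ 2) ?nnegrE ?vlen_ge0 ?invr_ge0// sqr_vlen sqr_c//.
have h1 : x k ^+ 2 <= ((2 * T)%:R^-1) ^+ 2.
  by rewrite -[x k ^+ 2]real_normK ?num_real// lerXn2r ?nnegrE ?invr_ge0.
have h2 : n%:R^-1 <= ((2 * T)%:R^-1) ^+ 2 :> R.
  rewrite exprVn lef_pV2 ?posrE ?exprn_gt0 ?ltr0n ?muln_gt0//.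
  by rewrite -natrX ler_nat expnMn.
have h3 : ((2 * T)%:R^-1) ^+ 2 = (T%:R^-1) ^+ 2 / 4 :> R.
  by rewrite natrM; field; rewrite gt_eqF.
have h4 : 0 <= (T%:R^-1) ^+ 2 :> R by exact: sqr_ge0.
rewrite h3 in h1 h2; lra.
Qed.

(** [Crn] has (n-2)! / n^(n-2) where an exact normalisation would have (n-1)! / n^(n-1); the
    quotient of the two is n / (n - 1). *)
Lemma Crn0_normalization (n : nat) : (1 < n)%N ->
  Crn R 0 n * (- 'i%C * n%:R) ^+ n.-1 = n.-1`!%:R * (n%:R / n.-1%:R) :> R[i].
Proof.
case: n => [|[|n]]// _; rewrite /Crn muln0 add0n fact0 mulr1 /= subn2 subn1/=.
have i1 : ('i%C : R[i]) ^+ n.+1 * (- 'i%C) ^+ n.+1 = 1.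
  by rewrite -exprMn mulrN -expr2 sqr_i opprK expr1n.
have n0 : (n.+2%:R : R[i]) != 0 by rewrite pnatr_eq0.
have n1 : (n.+1%:R : R[i]) != 0 by rewrite pnatr_eq0.
have nn := expf_neq0 n n0.
rewrite exprMn factS natrM (exprS _ n : n.+2%:R ^+ n.+1 = _).
rewrite [LHS](_ : _ = n`!%:R * (('i%C : R[i]) ^+ n.+1 * (- 'i%C) ^+ n.+1) * n.+2%:R).
  rewrite i1; move: (n.+2%:R) (n.+1%:R) n1 => a b b0.
  by field.
move: (n.+2%:R) n0 nn => a a0 an0.
by field.
Qed.

(* The normalisation makes the value of the Gaussian integral irrelevant: both the
   constant in [integral_representation] and [gauss_mass] are only compared with
   the integral at xi = 0. *)
Lemma hermite_sum_integral (n : nat) (x : 'I_n -> R) : (1 < n)%N ->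
  injective x -> \sum_(k < n) x k = 0 -> \sum_(k < n) x k ^+ 2 = 1 ->
  (forall k, vlen x k ^+ 2 * 2 <= 1) -> integral_der x 0 0 != 0 ->
  exists2 lam : R[i], lam * integral_der x 0 0 = n%:R / n.-1%:R &
    forall r xi, xi != 0 -> hermite_sum r x xi = (-1) ^+ r * (lam * integral_der x r xi).
Proof.
move=> n1 xi_inj sx sx2 v2 I0.
have n0 : (0 < n)%N by exact: ltnW.
have [nu rep] := integral_representation n1 xi_inj.
have norm0 := integral_normalization n1 xi_inj sx sx2 v2 rep.
have f0 : (n.-1`!%:R : R[i]) != 0 by rewrite pnatr_eq0 -lt0n fact_gt0.
have nu0 : nu != 0.
  by apply: contraNneq (mulf_neq0 f0 I0) => nu0; rewrite norm0 nu0 mul0r.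
exists (Crn R 0 n / nu).
  apply: (mulfI f0); rewrite -Crn0_normalization// mulrCA norm0.
  by rewrite mulrA divfK.
move=> r xi xi0.
pose U : set R := [set t | t != 0].
have oU : open U by exact: open_neq.
pose F (b : nat) (t : R) : R[i] := Crn R 0 n / nu * integral_der x b t.
pose G (r : nat) (t : R) : R[i] := Crn R 0 n *
  \sum_(b < r.+1) 'C(r, b)%:R * (negpow_der n b t * expsum_der x (r - b) t).
(* Both towers are differentiated on the nonzero reals only, where order 0 is the integral
   representation. *)
have FG : F r xi = G r xi.
  apply: (@tower_eq _ U) => //.
  - move=> b t _; apply: is_cderiveZ; exact: is_cderive_integral_der.
  - move=> b t t0; apply: is_cderiveZ; apply: is_cderive_leibniz => b' _.
      exact: is_cderive_negpow_der.
    exact: is_cderive_expsum_der.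
  - move=> t t0; rewrite /F /G big_ord1 bin0 mul1r subnn /negpow_der big_ord0 mul1r addn0.
    have tC0 : (t%:C)%C ^+ n.-1 != 0 :> R[i].
      by rewrite expf_neq0// eq_complex/= eqxx andbT.
    apply: (mulfI tC0); rewrite mulrCA rep//.
    by field; rewrite nu0 tC0.
rewrite -/(F r xi) FG /G -hermite_sumE// mulrA -expr2 sqrr_sign mul1r.
by [].
Qed.

End Normalization.

Lemma Snorm_le (R : realType) (p q : nat) (F : nat -> R -> R[i]) (M : R) :
  (forall b xi, is_cderive (F b) xi (F b.+1 xi)) ->
  (forall xi, `|xi| ^+ p * Normc.normc (F q xi) <= M) ->
  cderivable q (F 0) /\ (Snorm p q (F 0%N) <= M%:E)%E.
Proof.
move=> dF FM; split.
  move=> k xi _; have [-> ->] := tower_derive1n k dF.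
  by have [[hr _] [hi _]] := dF k xi; split; [exact: hr|exact: hi].
have M0 : 0 <= M.
  by apply: le_trans (FM 0); rewrite mulr_ge0 ?exprn_ge0// normc_ge0.
(* The other branch in the definition of the norm has value 0, which [M0] covers. *)
rewrite /Snorm unlock; case: ifP => _; last by rewrite lee_fin.
apply/ess_supP; apply: aeW => xi /=; rewrite lee_fin /cderive.
have [-> ->] := tower_derive1n q dF.
rewrite ger0_norm ?mulr_ge0 ?exprn_ge0 ?sqrtr_ge0//.
by apply: le_trans (FM xi); case: (F q xi).
Qed.

(** * Choice of the thresholds and assembly of the error bound *)

Theorem corollary3 (R : realType) (p q r : nat) :
  exists (N : nat) (delta C : R), 0 < delta /\
  forall (n : nat) (x : 'I_n -> R) (m : R),
    (N <= n)%N ->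
    (forall i j : 'I_n, (i < j)%N -> x i < x j) ->
    \sum_(k < n) x k = 0 ->
    \sum_(k < n) x k ^+ 2 = 1 ->
    \sum_(k < n) `|x k| ^+ 3 <= delta ->
    0 < m ->
    m ^+ 3 = \sum_(k < n)
      Num.sqrt (x k ^+ 2 + ((Num.sqrt n%:R)^-1) ^+ 2) ^+ 3 ->
    exists2 g : R -> R[i],
      (forall xi : R, xi != 0 -> g xi = hermite_sum r x xi) /\
      ccontinuous_at 0 g &
      let f := fun xi => g xi - ((He r xi * gauss xi)%:C)%C in
      cderivable q f /\ (Snorm p q f <= (C * m ^+ 3)%:E)%E.
Proof.
have [K1 [C1 [K10 C10 H1]]] := @integral_der_diff R p (r + q).
have [K2 [C2 [K20 C20 H2]]] := @integral_der_diff R 0 0.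
have [C3 H3] := @gauss_der_bound R p (r + q).
have C30 : 0 <= C3.
  by apply: le_trans (H3 0); rewrite mulr_ge0 ?exprn_ge0// normc_ge0.
pose kap : R := gauss_mass; have kap0 : 0 < kap by exact: gauss_mass_gt0.
have archi : 4 * C2 / kap <= (Num.bound (4 * C2 / kap))%:R.
  by apply/ltW/archi_boundP; rewrite divr_ge0 ?mulr_ge0// ltW.
(* All |v_k| will be at most 1 / T. The first two summands give the smallness required by K1 and K2;
   the third gives C2 m^3 <= kap / 2, because m^3 <= 2 / T. *)
pose T := (2 * K1 + 2 * K2 + Num.bound (4 * C2 / kap))%N.
have T0 : (0 < T)%N.
  by apply: (@leq_trans (2 * K1)); rewrite ?muln_gt0// /T -addnA leq_addr.
have TR : 0 < T%:R :> R by rewrite ltr0n.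
exists (4 * T ^ 2)%N, (((2 * T)%:R^-1) ^+ 3), (4 / kap * C1 + (4 / kap * C2 + 2) * C3).
split; first by rewrite exprn_gt0// invr_gt0 ltr0n muln_gt0.
move=> n x m Nn x_incr sx sx2 sx3 m0; rewrite -/(vcube x) => mE; rewrite mE.
have n1 : (1 < n)%N.
  by apply: leq_trans Nn; apply: (@leq_trans (4 * 1)) => //; rewrite leq_mul2l expn_gt0 T0.
have n0 : (0 < n)%N by exact: ltnW.
have x_inj : injective x.
  move=> i j xij; apply/val_inj; case: (ltngtP i j) => // /x_incr.
    by rewrite xij ltxx.
  by rewrite xij ltxx.
have vT k : vlen x k <= T%:R^-1 by exact: vlen_le_of_cubes.
have small (K : nat) k : (2 * K <= T)%N -> vlen x k ^+ 2 * (2 * K)%:R <= 1.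
  move=> KT; apply: (@le_trans _ _ (T%:R^-1 * T%:R)); last by rewrite mulVf// gt_eqF.
  apply: ler_pM; rewrite ?sqr_ge0// ?ler_nat//.
  rewrite expr2; apply: le_trans (_ : vlen x k * 1 <= _); last by rewrite mulr1.
  rewrite ler_wpM2l ?vlen_ge0// (le_trans (vT k))// invf_le1//.
  by rewrite ler1n.
have v1 k : vlen x k ^+ 2 * (2 * K1)%:R <= 1 by apply: small; rewrite /T -addnA leq_addr.
have v2 k : vlen x k ^+ 2 * (2 * K2)%:R <= 1 by apply: small; rewrite /T addnAC leq_addl.
have v3 k : vlen x k ^+ 2 * 2 <= 1 by exact: (@vlen_sqr2_le1 R n K1).
set V := vcube x; have V0 : 0 <= V by exact: vcube_ge0.
have VT : C2 * V <= kap / 2.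
  have h : V * T%:R <= 2.
    rewrite -ler_pdivlMr// mulrC; exact: vcube_le.
  have h' : 4 * C2 / kap <= T%:R.
    by apply: le_trans archi _; rewrite ler_nat leq_addl.
  rewrite ler_pdivlMr//; move: h'; rewrite ler_pdivrMr// => h'.
  have : V * (4 * C2) <= V * (T%:R * kap) by rewrite ler_wpM2l.
  have : V * T%:R * kap <= 2 * kap by rewrite ler_wpM2r// ltW.
  rewrite (mulrA V T%:R); move: (V * T%:R * kap) => a h1 h2; lra.
pose I0 := integral_der x 0 0.
have I0diff : Normc.normc (I0 - (kap%:C)%C) <= C2 * V.
  have g0 : gauss_der 0 0 = 1 :> R[i].
    by rewrite /gauss_der /log_tower/= /gauss expr0n mul0r oppr0 expR0.
  by have := H2 n x n1 sx sx2 v2 0 0 (leqnn 0); rewrite expr0 mul1r g0 mulr1.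
(* The integral at 0 stays away from 0, so the normalisation can be divided by it; this gives |lam|
   <= 4 / kap. *)
have I0ge : kap / 2 <= Normc.normc I0.
  have := le_normcD (- (I0 - (kap%:C)%C)) I0; rewrite opprB subrK normcR gtr0_norm// normc_sub.
  move: I0diff VT; lra.
have I0gt0 : 0 < Normc.normc I0 by apply: lt_le_trans I0ge; rewrite divr_gt0.
have I0neq0 : I0 != 0.
  by apply: contraTneq I0gt0 => ->; rewrite Normc.normc0 ltxx.
have [lam lamI0 lamH] := hermite_sum_integral n1 x_inj sx sx2 v3 I0neq0.
pose rho : R[i] := n%:R / n.-1%:R.
have n2 : (n <= 2 * n.-1)%N by move: n1; case: (n) => [|[|e]]// _; rewrite mulSn mul1n /= addSn ltnS leq_addl.
have np0 : 0 < n.-1%:R :> R by rewrite ltr0n -ltnS prednK.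
have rho_le2 : Normc.normc rho <= 2.
  rewrite Normc.normcM Normc.normcV !normc_nat ler_pdivrMr//.
  by rewrite -natrM ler_nat.
have rho1 : Normc.normc (rho - 1) <= 2 * V.
  have np0C : (n.-1%:R : R[i]) != 0 by rewrite pnatr_eq0 -lt0n -ltnS prednK.
  have -> : rho - 1 = n.-1%:R^-1.
    by rewrite /rho -{1}(prednK n0) -natr1; field.
  rewrite Normc.normcV normc_nat; apply: le_trans (_ : 2 * n%:R^-1 <= _).
    rewrite -div1r ler_pdivrMr// mulrAC ler_pdivlMr ?ltr0n// mul1r.
    by rewrite -natrM ler_nat.
  by rewrite ler_wpM2l// inv_n_le_vcube.
have lam_le : Normc.normc lam <= 4 / kap.
  have lI : Normc.normc lam * Normc.normc I0 <= 2 by rewrite -Normc.normcM lamI0.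
  rewrite ler_pdivlMr//; apply: le_trans (_ : 2 * (Normc.normc lam * Normc.normc I0) <= _).
    rewrite mulrCA; apply: ler_wpM2l; first exact: normc_ge0.
    by move: I0ge; lra.
  by move: lI; lra.
have lamkap : Normc.normc (lam * (kap%:C)%C - 1) <= (4 / kap * C2 + 2) * V.
  have -> : lam * (kap%:C)%C - 1 = - (lam * (I0 - (kap%:C)%C)) + (rho - 1).
    by rewrite /rho -lamI0 -/I0; ring.
  apply: le_trans (le_normcD _ _) _; rewrite normcN Normc.normcM mulrDl lerD//.
  by rewrite -mulrA; apply: ler_pM; rewrite ?normc_ge0.
(* The tower of the error: its order 0 already contains r derivatives, so the seminorm needs order r
   + q. *)
pose F (b : nat) (xi : R) : R[i] :=
  (-1) ^+ r * (lam * integral_der x (r + b) xi - gauss_der (r + b) xi).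
have dF b xi : is_cderive (F b) xi (F b.+1 xi).
  apply: is_cderiveZ; rewrite addnS.
  apply: is_cderiveD; first by apply: is_cderiveZ; exact: is_cderive_integral_der.
  have := is_cderiveZ (-1) (is_cderive_gauss_der (r + b) xi); rewrite mulN1r.
  by under eq_fun do rewrite mulN1r.
exists (fun xi => (-1) ^+ r * (lam * integral_der x r xi)).
  split=> [xi xi0|]; first by rewrite lamH.
  have [[hr _] [hi _]] := is_cderiveZ ((-1) ^+ r) (is_cderiveZ lam
    (is_cderive_integral_der n1 sx sx2 v3 r 0)).
  split; apply: differentiable_continuous; apply/derivable1_diffP; [exact: hr|exact: hi].
rewrite /=.
have -> : (fun xi => (-1) ^+ r * (lam * integral_der x r xi) - ((He r xi * gauss xi)%:C)%C) = F 0%N.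
  apply/funext => xi; rewrite /F addn0 mulrBr gauss_derE; congr (_ - _).
  rewrite /He divfK ?gt_eqF ?gauss_gt0// rmorphM rmorphXn/=.
  by rewrite rmorphN1.
apply: Snorm_le => // xi; rewrite /F Normc.normcM normcX normcN Normc.normc1 expr1n mul1r.
(* The first term is the error of the integral, scaled by lam; the second is the error lam kap - 1
   of the normalisation, times a bounded Gaussian derivative. They account for the two summands of
   the constant. *)
have -> : lam * integral_der x (r + q) xi - gauss_der (r + q) xi =
    lam * (integral_der x (r + q) xi - (kap%:C)%C * gauss_der (r + q) xi) +
    (lam * (kap%:C)%C - 1) * gauss_der (r + q) xi by ring.
apply: le_trans (ler_wpM2l _ (le_normcD _ _)) _; first by rewrite exprn_ge0.
rewrite !Normc.normcM mulrDr mulrDl; apply: lerD.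
- rewrite mulrCA [leRHS](_ : _ = 4 / kap * (C1 * V)); last by rewrite mulrA.
  apply: ler_pM; rewrite ?mulr_ge0 ?exprn_ge0 ?normc_ge0//.
  exact: H1.
- rewrite mulrCA [leRHS]mulrAC.
  by apply: ler_pM; rewrite ?mulr_ge0 ?exprn_ge0 ?normc_ge0.
Qed.
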